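(* Let $\mathcal{T}_1$ and $\mathcal{T}_2$ be Horn-$\mathcal{ALC}$ TBoxes and $\Theta=(\Sigma_1,\Sigma_2)$ a pair of signatures. Then $\mathcal{T}_1$ $\Theta$-CQ entails $\mathcal{T}_2$ if and only if for every tree-shaped $\Sigma_1$-ABox $\mathcal{A}$ of outdegree at most $|\mathcal{T}_2|$ that is consistent with both $\mathcal{T}_1$ and $\mathcal{T}_2$, the canonical model $\mathcal{I}_{\mathcal{T}_2,\mathcal{A}}$ is $\Sigma_2$-homomorphically embeddable into the canonical model $\mathcal{I}_{\mathcal{T}_1,\mathcal{A}}$.
   Context: A TBox is a finite set of inclusions between $\mathcal{ALC}$ concepts; $|\mathcal{T}|$ is its size; it is Horn-$\mathcal{ALC}$ if no $\neg C$ occurs negatively and no $\exists R.\neg C$ occurs positively. An ABox is a finite set of assertions $A(a)$, $R(a,b)$; a $\Sigma_1$-ABox uses only names from $\Sigma_1$. $\mathcal{A}$ is tree-shaped if the undirected graph with nodes $\mathsf{ind}(\mathcal{A})$ and edges $\{a,b\}$ for $R(a,b)\in\mathcal{A}$ is a tree, and $R(a,b)\in\mathcal{A}$ implies $S(a,b)\notin\mathcal{A}$ for $S\ne R$ and $S(b,a)\notin\mathcal{A}$ for all $S$; its outdegree is the maximal number of children of a node. Interpretations satisfy $a^{\mathcal{I}}=a$. For a consistent Horn-$\mathcal{ALC}$ KB $(\mathcal{T},\mathcal{A})$, the canonical model $\mathcal{I}_{\mathcal{T},\mathcal{A}}$ is the model produced by the standard chase (with $\mathcal{T}$ in normal form with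 inclusions $A\sqsubseteq B$, $A_1\sqcap A_2\sqsubseteq B$, $\exists R.A\sqsubseteq B$, $A\sqsubseteq\bot$, $\top\sqsubseteq B$, $A\sqsubseteq\exists R.B$, $A\sqsubseteq\forall R.B$: exhaustively add forced assertions, creating a fresh $R$-successor in $B$ for $A(a)$ and $A\sqsubseteq\exists R.B$ when none exists); it is complete for UCQ answering over the KB. A CQ is a formula $\exists\vec y\,\varphi(\vec x,\vec y)$ with $\varphi$ a conjunction of atoms $A(z)$, $R(z,z')$. $\mathcal{T}_1$ $\Theta$-CQ entails $\mathcal{T}_2$ if for every $\Sigma_1$-ABox $\mathcal{A}$ consistent with both TBoxes, every CQ $q(\vec x)$ over names in $\Sigma_2$ and every tuple $\vec a$ from $\mathsf{ind}(\mathcal{A})$, $(\mathcal{T}_2,\mathcal{A})\models q(\vec a)$ implies $(\mathcal{T}_1,\mathcal{A})\models q(\vec a)$. $\mathcal{I}$ is $\Sigma_2$-homomorphically embeddable into $\mathcal{J}$ if there is a map $h:\Delta^{\mathcal{I}}\to\Delta^{\mathcal{J}}$ preserving membership in all $\Sigma_2$-concept names and $\Sigma_2$-role names with $h(a)=a$ for all $a\in\mathsf{ind}(\mathcal{A})$. *)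

(* Defs.v *)
From HB Require Import structures.
From mathcomp Require Import all_boot.

Set Implicit Arguments.
Unset Strict Implicit.
Unset Printing Implicit Defensive.

Definition cname := nat.
Definition rname := nat.
Definition iname := nat.

Inductive concept :=
  | Top
  | Bot
  | Atom of cname
  | Neg of concept
  | And of concept & concept
  | Or of concept & concept
  | Ex of rname & concept
  | All of rname & concept.

Lemma concept_comparable : comparable concept.
Proof. by rewrite /comparable /decidable; do !decide equality. Defined.
HB.instance Definition _ := hasDecEq.Build concept (compareP concept_comparable).

(* (C, D) is the inclusion of C in D; a list is read as the finite set of its
   members. *)
Definition tbox := seq (concept * concept).

Fixpoint concept_size (C : concept) : nat :=
  match C with
  | Top | Bot | Atom _ => 1
  | Neg D => (concept_size D).+1
  | And D1 D2 | Or D1 D2 => (concept_size D1 + concept_size D2).+1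
  | Ex _ D | All _ D => (concept_size D).+2
  end.

(* The number of symbols (names, connectives, quantifiers, inclusion signs). *)
Definition tbox_size (T : tbox) : nat :=
  \sum_(CD <- undup T) (concept_size CD.1 + concept_size CD.2).+1.

(* [occurs E p C]: E has a positive (p = true) or negative (p = false)
   occurrence in C. *)
Fixpoint occurs (E : concept) (p : bool) (C : concept) : Prop :=
  (p /\ E = C) \/
  match C with
  | Top | Bot | Atom _ => False
  | Neg D => occurs E (~~ p) D
  | And D1 D2 | Or D1 D2 => occurs E p D1 \/ occurs E p D2
  | Ex _ D | All _ D => occurs E p D
  end.

Definition tbox_occurs (E : concept) (p : bool) (T : tbox) : Prop :=
  exists2 CD, CD \in T & occurs E (~~ p) CD.1 \/ occurs E p CD.2.

(* The last two clauses are needed because Or and All are constructors here, not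
   abbreviations by duality: a positive Or E F = Neg (And (Neg E) (Neg F)) hides
   a negative negation, and a negative All R E = Neg (Ex R (Neg E)) hides a
   positive Ex R (Neg E).  A positive All is allowed, as in the normal form. *)
Definition horn (T : tbox) : Prop :=
  [/\ forall E, ~ tbox_occurs (Neg E) false T,
      forall R E, ~ tbox_occurs (Ex R (Neg E)) true T,
      forall E F, ~ tbox_occurs (Or E F) true T
    & forall R E, ~ tbox_occurs (All R E) false T].

Record signature := Signature {
  sig_concept : cname -> Prop;
  sig_role : rname -> Prop
}.

(* [(A, a) \in c_assertions] is the assertion A(a), and
   [(R, a, b) \in r_assertions] is R(a, b). *)
Record abox := ABox {
  c_assertions : seq (cname * iname);
  r_assertions : seq (rname * iname * iname)
}.

Definition individuals (A : abox) : seq iname :=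
  [seq x.2 | x <- c_assertions A] ++
  flatten [seq [:: x.1.2; x.2] | x <- r_assertions A].

Definition sig_abox (Sigma : signature) (A : abox) : Prop :=
  (forall B a, (B, a) \in c_assertions A -> sig_concept Sigma B) /\
  (forall R a b, (R, a, b) \in r_assertions A -> sig_role Sigma R).

Definition edge (A : abox) : rel iname := fun a b =>
  has (fun x => ((x.1.2 == a) && (x.2 == b)) || ((x.1.2 == b) && (x.2 == a)))
    (r_assertions A).

Definition connected (A : abox) : Prop :=
  forall a b, a \in individuals A -> b \in individuals A ->
    exists p, path (edge A) a p /\ last a p = b.

(* Cycles of length 1 and 2 need not be excluded here: self-loops are excluded
   by [single_edges], and two nodes are joined by at most one edge of the
   undirected graph. *)
Definition acyclic (A : abox) : Prop :=
  forall c, 2 < size c -> ~ ucycle (edge A) c.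

Definition single_edges (A : abox) : Prop :=
  forall R a b, (R, a, b) \in r_assertions A ->
    (forall S, S <> R -> (S, a, b) \notin r_assertions A) /\
    (forall S, (S, b, a) \notin r_assertions A).

(* The empty ABox counts as tree-shaped. *)
Definition tree_shaped (A : abox) : Prop :=
  [/\ connected A, acyclic A & single_edges A].

(* b is a child of a in the tree A with root r: b is a neighbour of a that is
   not on the simple path from r to a. *)
Definition child (A : abox) (r a b : iname) : Prop :=
  exists p, [/\ path (edge A) r p, uniq (r :: p), last r p = a, edge A a b
              & b \notin r :: p].

(* A may be rooted so that no node has more than n children. *)
Definition outdegree_le (A : abox) (n : nat) : Prop :=
  individuals A = [::] \/
  exists2 r, r \in individuals A &
    forall a s, a \in individuals A -> uniq s ->
      (forall b, b \in s -> child A r a b) -> size s <= n.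

(* Individual names are objects, so that each of them can denote itself. *)
Inductive obj (X : Type) :=
  | Named of iname
  | Anon of X.
Arguments Named {X}.
Arguments Anon {X}.

Record interp (X : Type) := Interp {
  dom : obj X -> Prop;
  cint : cname -> obj X -> Prop;
  rint : rname -> obj X -> obj X -> Prop;
  dom_nonempty : exists d, dom d;
  cint_dom : forall A d, cint A d -> dom d;
  rint_dom : forall R d e, rint R d e -> dom d /\ dom e
}.

Fixpoint ext (X : Type) (I : interp X) (C : concept) (d : obj X) : Prop :=
  match C with
  | Top => dom I d
  | Bot => False
  | Atom A => cint I A d
  | Neg D => dom I d /\ ~ ext I D d
  | And D1 D2 => ext I D1 d /\ ext I D2 d
  | Or D1 D2 => ext I D1 d \/ ext I D2 d
  | Ex R D => exists e, rint I R d e /\ ext I D e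
  | All R D => dom I d /\ forall e, rint I R d e -> ext I D e
  end.

Definition model_tbox (X : Type) (I : interp X) (T : tbox) : Prop :=
  forall C D, (C, D) \in T -> forall d, ext I C d -> ext I D d.

Definition model_abox (X : Type) (I : interp X) (A : abox) : Prop :=
  (forall B a, (B, a) \in c_assertions A -> cint I B (Named a)) /\
  (forall R a b, (R, a, b) \in r_assertions A -> rint I R (Named a) (Named b)).

Definition consistent (T : tbox) (A : abox) : Prop :=
  exists (X : Type) (I : interp X), model_tbox I T /\ model_abox I A.

Definition var := nat.

(* Variables of the atoms that are not answer variables are existentially
   quantified. *)
Record cq := CQ {
  answer_vars : seq var;
  c_atoms : seq (cname * var);
  r_atoms : seq (rname * var * var)
}.

Definition sig_cq (Sigma : signature) (q : cq) : Prop :=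
  (forall A z, (A, z) \in c_atoms q -> sig_concept Sigma A) /\
  (forall R z z', (R, z, z') \in r_atoms q -> sig_role Sigma R).

Definition satisfies (X : Type) (I : interp X) (q : cq) (a : seq iname) : Prop :=
  exists pi : var -> obj X,
    [/\ forall z, dom I (pi z),
        [seq pi x | x <- answer_vars q] = [seq Named b | b <- a],
        forall A z, (A, z) \in c_atoms q -> cint I A (pi z)
      & forall R z z', (R, z, z') \in r_atoms q -> rint I R (pi z) (pi z')].

Definition kb_entails (T : tbox) (A : abox) (q : cq) (a : seq iname) : Prop :=
  forall (X : Type) (I : interp X),
    model_tbox I T -> model_abox I A -> satisfies I q a.

Definition cq_entails (Theta : signature * signature) (T1 T2 : tbox) : Prop :=
  forall A : abox, sig_abox Theta.1 A -> consistent T1 A -> consistent T2 A ->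
  forall q : cq, sig_cq Theta.2 q ->
  forall a : seq iname, size a = size (answer_vars q) ->
    (forall b, b \in a -> b \in individuals A) ->
    kb_entails T2 A q a -> kb_entails T1 A q a.

(* Concept names of normalised TBoxes: [Atom A] is the original name A, and any
   other concept C is the fresh name introduced for C. *)
Definition xname := concept.

Inductive nf_ci :=
  | NSub of xname & xname             (* A ⊑ B *)
  | NAnd of xname & xname & xname     (* A1 ⊓ A2 ⊑ B *)
  | NExL of rname & xname & xname     (* ∃R.A ⊑ B *)
  | NBot of xname                     (* A ⊑ ⊥ *)
  | NTop of xname                     (* ⊤ ⊑ B *)
  | NExR of xname & rname & xname     (* A ⊑ ∃R.B *)
  | NAllR of xname & rname & xname.   (* A ⊑ ∀R.B *)

Lemma nf_ci_comparable : comparable nf_ci.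
Proof. by rewrite /comparable /decidable; do !decide equality. Defined.
HB.instance Definition _ := hasDecEq.Build nf_ci (compareP nf_ci_comparable).

(* Structural transformation: writing X_C for the name of C, [nf_def true C]
   forces X_C ⊑ C and [nf_def false C] forces C ⊑ X_C.  The empty clauses for
   Or, Neg and All are those that [horn] rules out. *)
Fixpoint nf_def (p : bool) (C : concept) : seq nf_ci :=
  match C with
  | Top => if p then [::] else [:: NTop Top]
  | Bot => if p then [:: NBot Bot] else [::]
  | Atom _ => [::]
  | Neg D => if p then [:: NAnd C D Bot; NBot Bot] ++ nf_def false D else [::]
  | And D1 D2 =>
      (if p then [:: NSub C D1; NSub C D2] else [:: NAnd D1 D2 C])
      ++ nf_def p D1 ++ nf_def p D2
  | Or D1 D2 =>
      if p then [::]
      else [:: NSub D1 C; NSub D2 C] ++ nf_def false D1 ++ nf_def false D2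
  | Ex R D => (if p then NExR C R D else NExL R D C) :: nf_def p D
  | All R D => if p then NAllR C R D :: nf_def true D else [::]
  end.

Definition normal_form (T : tbox) : seq nf_ci :=
  flatten [seq NSub CD.1 CD.2 :: nf_def false CD.1 ++ nf_def true CD.2
          | CD <- T].

(* [NullInd a R B] and [NullSucc x R B] are the fresh R-successors in B of a
   and x. [NullRoot] is used for the empty ABox only: the domain of an
   interpretation is nonempty, so there the chase starts from one anonymous
   element. *)
Inductive null :=
  | NullRoot
  | NullInd of iname & rname & xname
  | NullSucc of null & rname & xname.

Definition fresh (d : obj null) (R : rname) (B : xname) : obj null :=
  match d with
  | Named a => Anon (NullInd a R B)
  | Anon x => Anon (NullSucc x R B)
  end.

Inductive fact :=
  | FDom of obj null
  | FConcept of xname & obj null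
  | FRole of rname & obj null & obj null.

Inductive abox_facts (A : abox) : fact -> Prop :=
  | AF_root : individuals A = [::] -> abox_facts A (FDom (Anon NullRoot))
  | AF_ind a : a \in individuals A -> abox_facts A (FDom (Named a))
  | AF_concept B a : (B, a) \in c_assertions A ->
      abox_facts A (FConcept (Atom B) (Named a))
  | AF_role R a b : (R, a, b) \in r_assertions A ->
      abox_facts A (FRole R (Named a) (Named b)).

(* One round of the chase applies all rules applicable to F.  The inclusions
   A ⊑ ⊥ add no facts: the canonical model is used for consistent KBs only. *)
Inductive chase_step (N : seq nf_ci) (F : fact -> Prop) : fact -> Prop :=
  | CS_keep f : F f -> chase_step N F f
  | CS_sub A B d : NSub A B \in N -> F (FConcept A d) ->
      chase_step N F (FConcept B d)
  | CS_and A1 A2 B d : NAnd A1 A2 B \in N ->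
      F (FConcept A1 d) -> F (FConcept A2 d) -> chase_step N F (FConcept B d)
  | CS_exl R A B d e : NExL R A B \in N ->
      F (FRole R d e) -> F (FConcept A e) -> chase_step N F (FConcept B d)
  | CS_top B d : NTop B \in N -> F (FDom d) -> chase_step N F (FConcept B d)
  | CS_all A R B d e : NAllR A R B \in N ->
      F (FConcept A d) -> F (FRole R d e) -> chase_step N F (FConcept B e)
  | CS_exr A R B d f : NExR A R B \in N -> F (FConcept A d) ->
      ~ (exists e, F (FRole R d e) /\ F (FConcept B e)) ->
      [\/ f = FDom (fresh d R B), f = FRole R d (fresh d R B)
        | f = FConcept B (fresh d R B)] ->
      chase_step N F f.

Fixpoint chase_stage (N : seq nf_ci) (A : abox) (n : nat) : fact -> Prop :=
  if n is m.+1 then chase_step N (chase_stage N A m) else abox_facts A.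

Definition chase (T : tbox) (A : abox) (f : fact) : Prop :=
  exists n, chase_stage (normal_form T) A n f.

Lemma chase_nonempty T A : exists d, chase T A (FDom d).
Proof.
case E: (individuals A) => [|a s].
  by exists (Anon NullRoot), 0; apply: AF_root.
by exists (Named a), 0; apply: AF_ind; rewrite E mem_head.
Qed.

Lemma chase_stage_dom N A n f : chase_stage N A n f ->
  match f with
  | FDom _ => True
  | FConcept _ d => chase_stage N A n (FDom d)
  | FRole _ d e => chase_stage N A n (FDom d) /\ chase_stage N A n (FDom e)
  end.
Proof.
elim: n f => [|n IH] f /=.
  case=> [//|//|B a Ba|R a b Rab].
    by apply: AF_ind; rewrite mem_cat (map_f snd Ba).
  by split; apply: AF_ind; rewrite mem_cat; apply/orP; right;
    apply/flattenP; exists [:: a; b]; rewrite ?inE ?eqxx ?orbT //;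
    exact: (map_f (fun x => [:: x.1.2; x.2]) Rab).
case=> {f} [f /IH|A1 B d _ /IH h|A1 A2 B d _ /IH h _|R A1 B d e _ /IH[h _] _
  |B d _ h|A1 R B d e _ _ /IH[_ h]|A1 R B d f AB h1 h2 hf]; try exact: CS_keep.
  case: f => [//|B d h|R d e [h1 h2]]; first exact: CS_keep.
  by split; exact: CS_keep.
have hd : chase_step N (chase_stage N A n) (FDom (fresh d R B)).
  by apply: (CS_exr AB h1 h2); constructor 1.
by case: hf => -> //; split=> //; exact/CS_keep/(IH _ h1).
Qed.

Lemma chase_concept_dom T A B d :
  chase T A (FConcept (Atom B) d) -> chase T A (FDom d).
Proof. by case=> n /chase_stage_dom h; exists n. Qed.

Lemma chase_role_dom T A R d e :
  chase T A (FRole R d e) -> chase T A (FDom d) /\ chase T A (FDom e).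
Proof. by case=> n /chase_stage_dom[h1 h2]; split; exists n. Qed.

Definition canonical_model (T : tbox) (A : abox) : interp null :=
  @Interp null (fun d => chase T A (FDom d))
    (fun B d => chase T A (FConcept (Atom B) d))
    (fun R d e => chase T A (FRole R d e))
    (chase_nonempty T A)
    (fun B d => @chase_concept_dom T A B d)
    (fun R d e => @chase_role_dom T A R d e).

Definition hom_embeddable (Sigma : signature) (A : abox) (X Y : Type)
    (I : interp X) (J : interp Y) : Prop :=
  exists h : obj X -> obj Y,
    [/\ forall d, dom I d -> dom J (h d),
        forall B d, sig_concept Sigma B -> cint I B d -> cint J B (h d),
        forall R d e, sig_role Sigma R -> rint I R d e -> rint J R (h d) (h e)
      & forall a, a \in individuals A -> h (Named a) = Named a].

(* Main.v *)
Require Import Defs.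
From HB Require Import structures.
From mathcomp Require Import all_boot.
From Stdlib Require Import Classical ClassicalEpsilon.

Set Implicit Arguments.
Unset Strict Implicit.
Unset Printing Implicit Defensive.

(* The canonical model is a model of the KB and maps homomorphically into every other one, so
   it decides which CQs are entailed.

   From left to right, CQ entailment embeds every finite part of the canonical model of T2.
   As its anonymous part is a forest, a homomorphism is a simulation, so it suffices
   to pass from simulations of every finite depth to one of infinite depth.  Along a
   Sigma_2-edge this works because elements of the canonical model of T1 have finitely many
   successors; along any other edge the target may be anywhere, but only
   finitely many targets matter, as what lies below a null is determined by its type.

   From right to left, let a be an individual of an arbitrary ABox A.  All names that reach a
   from its neighbours under T2 already reach the root of a finite tree unravelled from A at a
   in which each node has one child per name occurring in an inclusion that
   propagates information along roles, namely the neighbour that first yields this name.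
   So the part of the canonical model of (T2, A) below a maps into that
   of the tree, then by assumption into the one for T1, and from there back to A.  These
   homomorphisms, one for each a, fit together. *)

(** * The chase as a model of the normal form and of the TBox *)

Record nstruct (Y : Type) := NStruct {
  sdom : Y -> Prop;
  scon : xname -> Y -> Prop;
  srole : rname -> Y -> Y -> Prop;
  scon_dom : forall B d, scon B d -> sdom d;
  srole_dom : forall R d e, srole R d e -> sdom d /\ sdom e
}.

(* [NBot] is left out, as in the chase; see [bot_free]. *)
Definition sat_ci (Y : Type) (M : nstruct Y) (ci : nf_ci) : Prop :=
  match ci with
  | NSub A B => forall d, scon M A d -> scon M B d
  | NAnd A1 A2 B => forall d, scon M A1 d -> scon M A2 d -> scon M B d
  | NExL R A B => forall d e, srole M R d e -> scon M A e -> scon M B d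
  | NBot _ => True
  | NTop B => forall d, sdom M d -> scon M B d
  | NExR A R B => forall d, scon M A d -> exists e, srole M R d e /\ scon M B e
  | NAllR A R B => forall d e, scon M A d -> srole M R d e -> scon M B e
  end.

Definition closed_under (Y : Type) (M : nstruct Y) (N : seq nf_ci) : Prop :=
  forall ci, ci \in N -> sat_ci M ci.

Definition bot_free (Y : Type) (M : nstruct Y) (N : seq nf_ci) : Prop :=
  forall A d, NBot A \in N -> ~ scon M A d.

Lemma chase_stage_le N A m n f :
  m <= n -> chase_stage N A m f -> chase_stage N A n f.
Proof.
move=> /subnK <-; elim: (n - m) => [//|k IH] h.
by rewrite addSn; apply: CS_keep; apply: IH.
Qed.

Lemma chase_con_dom T A B d : chase T A (FConcept B d) -> chase T A (FDom d).
Proof. by case=> n /chase_stage_dom h; exists n. Qed.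

Definition chase_str (T : tbox) (A : abox) : nstruct (obj null) :=
  NStruct (fun B d => @chase_con_dom T A B d)
          (fun R d e => @chase_role_dom T A R d e).

Lemma chase_abox T A f : abox_facts A f -> chase T A f.
Proof. by exists 0. Qed.

Lemma chase_closed T A : closed_under (chase_str T A) (normal_form T).
Proof.
have two m n f g : chase_stage (normal_form T) A m f ->
    chase_stage (normal_form T) A n g ->
    chase_stage (normal_form T) A (maxn m n) f /\
    chase_stage (normal_form T) A (maxn m n) g.
  by move=> hf hg; split; [apply: chase_stage_le hf|apply: chase_stage_le hg];
    rewrite leq_max leqnn ?orbT.
case=> [B C|B1 B2 C|R B C|B|C|B R C|B R C] hN //= d.
- by case=> n h; exists n.+1; apply: CS_sub hN h.
- by case=> m h1 [n h2]; have [h3 h4] := two _ _ _ _ h1 h2;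
    exists (maxn m n).+1; apply: CS_and hN h3 h4.
- by move=> e [m h1] [n h2]; have [h3 h4] := two _ _ _ _ h1 h2;
    exists (maxn m n).+1; apply: CS_exl hN h3 h4.
- by case=> n h; exists n.+1; apply: CS_top hN h.
- case=> n h.
  (* A null is created only where stage [n] has no witness yet, so either a witness is there already
     or the next stage adds the fresh one. *)
  have [[e [h1 h2]]|no] := classic (exists e,
      chase_stage (normal_form T) A n (FRole R d e) /\
      chase_stage (normal_form T) A n (FConcept C e)).
    by exists e; split; exists n.
  by exists (fresh d R C); split; exists n.+1; apply: (CS_exr hN h no);
    [constructor 2|constructor 3].
- by move=> e [m h1] [n h2]; have [h3 h4] := two _ _ _ _ h1 h2;
    exists (maxn m n).+1; apply: CS_all hN h3 h4.
Qed.

Lemma ext_dom (X : Type) (I : interp X) C d : ext I C d -> dom I d.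
Proof.
elim: C d => //= [A d|D _ d|D1 IH1 D2 _ d|D1 IH1 D2 IH2 d|R D _ d|R D _ d].
- exact: cint_dom.
- by case.
- by case=> /IH1.
- by case=> [/IH1|/IH2].
- by case=> e [/rint_dom[]].
- by case.
Qed.

(** Each name of the normal form is read as the concept that it stands for. Arbitrary
    interpretations thus become structures of the same kind as the chase, without being expanded by
    fresh symbols. *)
Definition ext_str (X : Type) (I : interp X) : nstruct (obj X) :=
  NStruct (@ext_dom X I) (@rint_dom X I).

Lemma mem_normal_form T ci : ci \in normal_form T <->
  exists2 CD, CD \in T &
    ci \in NSub CD.1 CD.2 :: nf_def false CD.1 ++ nf_def true CD.2.
Proof.
split; first by move/flattenP => [s /mapP[CD CDT ->] h]; exists CD.
by case=> CD CDT h; apply/flattenP; eexists; last exact: h; apply: map_f.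
Qed.

(** Under this reading a clause only unfolds [ext] at one constructor, so it is a tautology. The
    TBox matters only for the clause that links the two sides of an inclusion. *)
Lemma ext_str_nf_def (X : Type) (I : interp X) p C ci :
  ci \in nf_def p C -> sat_ci (ext_str I) ci /\
  forall B d, ci = NBot B -> ~ ext I B d.
Proof.
elim: C p => /= [||B|D IH|D1 IH1 D2 IH2|D1 IH1 D2 IH2|R D IH|R D IH] [];
  rewrite ?mem_cat ?inE //=.
- by move/eqP->; split.
- by move/eqP->; split=> // B d [<-].
- case/or3P=> [/eqP->|/eqP->|/IH //]; split=> //=; first by move=> d [_ h] /h.
  by move=> B d [<-].
- by case/orP=> [/orP[]/eqP->|/orP[/IH1|/IH2]] //; split=> //= d [].
- by case/or3P=> [/eqP->|/IH1|/IH2] //; split.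
- rewrite mem_cat; case/or3P=> [/eqP->|/eqP->|/orP[/IH1|/IH2]] //; split=> //= d;
    by [left|right].
- by case/orP=> [/eqP->|/IH] //; split.
- by case/orP=> [/eqP->|/IH] //; split=> //= d e h1 h2; exists e.
- by case/orP=> [/eqP->|/IH] //; split=> //= d e [_]; apply.
Qed.

Lemma ext_str_closed (X : Type) (I : interp X) T :
  model_tbox I T -> closed_under (ext_str I) (normal_form T).
Proof.
move=> IT ci /mem_normal_form[[C D] CDT]; rewrite inE mem_cat.
case/or3P=> [/eqP->|h|h]; first by move=> d; apply: IT CDT d.
  by have [] := ext_str_nf_def I h.
by have [] := ext_str_nf_def I h.
Qed.

Lemma ext_str_bot_free (X : Type) (I : interp X) T :
  bot_free (ext_str I) (normal_form T).
Proof.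
move=> B d /mem_normal_form[[C D] CDT]; rewrite inE mem_cat.
by case/or3P=> [/eqP //|h|h]; have [_ /(_ B d erefl)] := ext_str_nf_def I h.
Qed.

(** The form of [horn] that suits induction on concepts: the polarity is a parameter that flips
    below a negation. *)
Fixpoint horn_concept (p : bool) (C : concept) : Prop :=
  match C with
  | Top | Bot | Atom _ => True
  | Neg D => p /\ horn_concept (~~ p) D
  | And D1 D2 => horn_concept p D1 /\ horn_concept p D2
  | Or D1 D2 => ~~ p /\ (horn_concept p D1 /\ horn_concept p D2)
  | Ex _ D => horn_concept p D
  | All _ D => p /\ horn_concept p D
  end.

Lemma occurs_horn (p : bool) C :
  (forall E, ~ occurs (Neg E) (~~ p) C) ->
  (forall E F, ~ occurs (Or E F) p C) ->
  (forall R E, ~ occurs (All R E) (~~ p) C) -> horn_concept p C.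
Proof.
elim: C p => //= [D IH|D1 IH1 D2 IH2|D1 IH1 D2 IH2|R D IH|R D IH] p h1 h2 h3.
- case: p h1 h2 h3 => /= h1 h2 h3; last by case: (h1 D); left.
  split=> //; apply: IH => /=.
  + by move=> E h; apply: (h1 E); right.
  + by move=> E F h; apply: (h2 E F); right.
  + by move=> R E h; apply: (h3 R E); right.
- by split; [apply: IH1|apply: IH2] => *; intro; [apply: h1|apply: h2|apply: h3
    |apply: h1|apply: h2|apply: h3]; right; eauto.
- case: p h1 h2 h3 => /= h1 h2 h3; first by case: (h2 D1 D2); left.
  by split=> //; split; [apply: IH1|apply: IH2] => *; intro;
    [apply: h1|apply: h2|apply: h3|apply: h1|apply: h2|apply: h3]; right; eauto.
- by apply: IH => *; intro; [apply: h1|apply: h2|apply: h3]; right; eauto.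
- case: p h1 h2 h3 => /= h1 h2 h3; last by case: (h3 R D); left.
  by split=> //; apply: IH => *; intro; [apply: h1|apply: h2|apply: h3]; right; eauto.
Qed.

Lemma horn_sides T C D : horn T -> (C, D) \in T ->
  horn_concept false C /\ horn_concept true D.
Proof.
case=> h1 _ h2 h3 CDT; split; apply: occurs_horn => *; intro.
- by apply: h1; exists (C, D) => //; left; eauto.
- by apply: h2; exists (C, D) => //; left; eauto.
- by apply: h3; exists (C, D) => //; left; eauto.
- by apply: h1; exists (C, D) => //; right; eauto.
- by apply: h2; exists (C, D) => //; right; eauto.
- by apply: h3; exists (C, D) => //; right; eauto.
Qed.

(** The clauses of [nf_def] force just the direction that the polarity asks for, and the Horn
    condition removes the compound concepts that have no clauses. [bot_free] stands in for the
    inclusions [NBot], on which the chase does not act. *)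
Lemma chase_nf_ext T A (p : bool) C : bot_free (chase_str T A) (normal_form T) ->
  {subset nf_def p C <= normal_form T} -> horn_concept p C ->
  forall d, if p then chase T A (FConcept C d) -> ext (canonical_model T A) C d
            else ext (canonical_model T A) C d -> chase T A (FConcept C d).
Proof.
move=> nobot; have cl := @chase_closed T A.
elim: C p => [||B|D IH|D1 IH1 D2 IH2|D1 IH1 D2 IH2|R D IH|R D IH] [] //= sub hC d.
- exact: chase_con_dom.
- by apply: (cl (NTop Top)); apply: sub; rewrite mem_head.
- by move=> h; apply: (nobot Bot d); rewrite ?sub ?mem_head.
- case: hC => _ hD h; split; first exact: chase_con_dom h.
  have subD : {subset nf_def false D <= normal_form T}.
    by move=> ci h1; apply: sub; rewrite !inE h1 !orbT.
  move/(IH false subD hD) => h1.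
  (* Deriving both [Neg D] and [D] would derive [Bot]. *)
  apply: (nobot Bot d); first by apply: sub; rewrite !inE eqxx !orbT.
  by apply: (cl (NAnd (Neg D) D Bot)) h h1; apply: sub; rewrite mem_head.
- by move: hC => [h _].
- have sub1 : {subset nf_def true D1 <= normal_form T}.
    by move=> ci h1; apply: sub; rewrite !inE mem_cat h1 !orbT.
  have sub2 : {subset nf_def true D2 <= normal_form T}.
    by move=> ci h1; apply: sub; rewrite !inE mem_cat h1 !orbT.
  case: hC => hD1 hD2 h; split.
    by apply: (IH1 true) => //; apply: (cl (NSub (And D1 D2) D1)) h; apply: sub;
      rewrite mem_head.
  by apply: (IH2 true) => //; apply: (cl (NSub (And D1 D2) D2)) h; apply: sub;
    rewrite !inE eqxx orbT.
- have sub1 : {subset nf_def false D1 <= normal_form T}.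
    by move=> ci h1; apply: sub; rewrite !inE mem_cat h1 !orbT.
  have sub2 : {subset nf_def false D2 <= normal_form T}.
    by move=> ci h1; apply: sub; rewrite !inE mem_cat h1 !orbT.
  case: hC => hD1 hD2 [h1 h2].
  apply: (cl (NAnd D1 D2 (And D1 D2))); first by apply: sub; rewrite mem_head.
    exact: (IH1 false).
  exact: (IH2 false).
- by move: hC => [h _].
- have sub1 : {subset nf_def false D1 <= normal_form T}.
    by move=> ci h1; apply: sub; rewrite !inE mem_cat h1 !orbT.
  have sub2 : {subset nf_def false D2 <= normal_form T}.
    by move=> ci h1; apply: sub; rewrite !inE mem_cat h1 !orbT.
  case: hC => _ [hD1 hD2] [] h.
    by apply: (cl (NSub D1 (Or D1 D2))); [apply: sub; rewrite mem_head|exact: (IH1 false)].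
  by apply: (cl (NSub D2 (Or D1 D2)));
    [apply: sub; rewrite !inE eqxx orbT|exact: (IH2 false)].
- move=> h; have [e [h1 h2]] : exists e, chase T A (FRole R d e) /\ chase T A (FConcept D e).
    by apply: (cl (NExR (Ex R D) R D)) h; apply: sub; rewrite mem_head.
  exists e; split=> //; apply: (IH true) => // ci h3.
  by apply: sub; rewrite inE h3 orbT.
- case=> e [h1 h2]; apply: (cl (NExL R D (Ex R D))) h1 _; first by apply: sub; rewrite mem_head.
  by apply: (IH false) => // ci h3; apply: sub; rewrite inE h3 orbT.
- move=> h; split; first exact: chase_con_dom h.
  move=> e h1; apply: (IH true) => //; last 1 first.
  + by apply: (cl (NAllR (All R D) R D)) h h1; apply: sub; rewrite mem_head.
  + by move=> ci h3; apply: sub; rewrite inE h3 orbT.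
  + by move: hC => [_ h4].
- by move: hC => [h _].
Qed.

Lemma chase_model_tbox T A : horn T ->
  bot_free (chase_str T A) (normal_form T) -> model_tbox (canonical_model T A) T.
Proof.
move=> hT nobot C D CDT d hC; have [h1 h2] := horn_sides hT CDT.
have sub ci : ci \in NSub C D :: nf_def false C ++ nf_def true D ->
    ci \in normal_form T by move=> h; apply/mem_normal_form; exists (C, D).
apply: (chase_nf_ext (p := true)) => //.
  by move=> ci h; apply: sub; rewrite inE mem_cat h !orbT.
apply: (@chase_closed T A (NSub C D) (sub _ (mem_head _ _)) d).
apply: (chase_nf_ext (p := false)) => //.
by move=> ci h; apply: sub; rewrite inE mem_cat h !orbT.
Qed.

Lemma canonical_model_abox T A : model_abox (canonical_model T A) A.
Proof.
by split=> *; apply: chase_abox; [apply: AF_concept|apply: AF_role].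
Qed.

(** * Homomorphisms out of the chase *)

(* Extends a map along the nulls: [seed] prescribes values, and [nx d e R B] is the value
   at [fresh d R B] when [d] is sent to [e]. *)
Fixpoint null_map (Y : Type) (seed : obj null -> option Y) (dflt : Y)
    (nx : obj null -> Y -> rname -> xname -> Y) (x : null) : Y :=
  match seed (Anon x) with
  | Some e => e
  | None =>
    match x with
    | NullRoot => dflt
    | NullInd a R B => nx (Named a) (odflt dflt (seed (Named a))) R B
    | NullSucc y R B => nx (Anon y) (null_map seed dflt nx y) R B
    end
  end.

Definition obj_map (Y : Type) seed dflt nx (d : obj null) : Y :=
  match d with
  | Named a => odflt dflt (seed (Named a))
  | Anon x => null_map seed dflt nx x
  end.

Lemma obj_map_seed (Y : Type) seed (dflt : Y) nx d e :
  seed d = Some e -> obj_map seed dflt nx d = e.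
Proof. by case: d => [a|[|a R B|x R B]] /= ->. Qed.

Lemma obj_map_fresh (Y : Type) seed (dflt : Y) nx d R B :
  seed (fresh d R B) = None ->
  obj_map seed dflt nx (fresh d R B) = nx d (obj_map seed dflt nx d) R B.
Proof. by case: d => [a|x] /= ->. Qed.

Definition some_witness (Y : Type) (M : nstruct Y) (_ : obj null) (e : Y)
    (R : rname) (B : xname) : Y :=
  epsilon (inhabits e) (fun e' => srole M R e e' /\ scon M B e').

Lemma some_witnessP (Y : Type) (M : nstruct Y) d e R B :
  (exists e', srole M R e e' /\ scon M B e') ->
  srole M R e (some_witness M d e R B) /\ scon M B (some_witness M d e R B).
Proof. exact: epsilon_spec. Qed.

Definition preserves (Y : Type) (M : nstruct Y) (P : obj null -> Prop)
    (K : obj null -> obj null -> Prop) (h : obj null -> Y) (f : fact) : Prop :=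
  match f with
  | FDom d => P d -> sdom M (h d)
  | FConcept B d => P d -> scon M B (h d)
  | FRole R d e => K d e -> srole M R (h d) (h e)
  end.

(* [h] is a homomorphism on the part of the chase with elements [P] and edges [K], provided
   that the concepts entering this part along other edges are respected.  Witnesses in
   the chase are only created when needed, but as [h] is read off [M], the
   chase need not be compared with that of another ABox. *)
Lemma chase_stage_hom (N : seq nf_ci) (A : abox) (Y : Type) (M : nstruct Y)
    (P : obj null -> Prop) (K : obj null -> obj null -> Prop)
    (h : obj null -> Y) (n : nat) :
  closed_under M N ->
  (forall d e, K d e -> P d /\ P e) ->
  (forall d R B, P d -> (exists e, srole M R (h d) e /\ scon M B e) ->
    srole M R (h d) (h (fresh d R B)) /\ scon M B (h (fresh d R B))) ->
  (forall f, abox_facts A f -> preserves M P K h f) ->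
  (forall m R C B d e, m < n -> NExL R C B \in N ->
    chase_stage N A m (FRole R d e) -> chase_stage N A m (FConcept C e) ->
    P d -> ~ K d e -> scon M B (h d)) ->
  (forall m R C B d e, m < n -> NAllR C R B \in N ->
    chase_stage N A m (FConcept C d) -> chase_stage N A m (FRole R d e) ->
    P e -> ~ K d e -> scon M B (h e)) ->
  (forall m R C B d, m < n -> NExR C R B \in N ->
    chase_stage N A m (FConcept C d) ->
    chase_stage N A m.+1 (FConcept B (fresh d R B)) ->
    P (fresh d R B) -> ~ P d -> scon M B (h (fresh d R B))) ->
  forall m f, m <= n -> chase_stage N A m f -> preserves M P K h f.
Proof.
move=> cl KP wit base exl allr exr; elim=> [|m IH] f lemn; first exact: base.
have ltmn : m < n by [].
have {}IH := IH _ (ltnW lemn).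
case=> {f} [f|C B d|C1 C2 B d|R C B d e|B d|C R B d e|C R B d f].
- exact: IH.
- by move=> /cl h1 /IH h2 Pd; apply: h1 (h2 Pd).
- by move=> /cl h1 /IH h2 /IH h3 Pd; apply: h1 (h2 Pd) (h3 Pd).
- move=> hN h1 h2 Pd; have [Kde|nK] := classic (K d e).
    by apply: (cl _ hN) (IH _ h1 Kde) (IH _ h2 _); have [] := KP _ _ Kde.
  exact: exl hN h1 h2 Pd nK.
- by move=> /cl h1 /IH h2 Pd; apply: h1 (h2 Pd).
- move=> hN h1 h2 Pe; have [Kde|nK] := classic (K d e).
    by apply: (cl _ hN) (IH _ h1 _) (IH _ h2 Kde); have [] := KP _ _ Kde.
  exact: allr hN h1 h2 Pe nK.
- move=> hN h1 no hf.
  have hc : P (fresh d R B) -> scon M B (h (fresh d R B)).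
    move=> Pf; have [Pd|nPd] := classic (P d).
      by have [] := wit d R B Pd (cl _ hN _ (IH _ h1 Pd)).
    apply: (exr _ _ _ _ _ ltmn hN h1 _ Pf nPd).
    by apply: (CS_exr hN h1 no); constructor 3.
  case: hf => -> /=; last exact: hc.
    by move/hc; apply: scon_dom.
  move=> Kd; have [Pd _] := KP _ _ Kd.
  by have [] := wit d R B Pd (cl _ hN _ (IH _ h1 Pd)).
Qed.

Lemma individualsP A a : a \in individuals A <->
  (exists B, (B, a) \in c_assertions A) \/
  (exists R b, (R, a, b) \in r_assertions A \/ (R, b, a) \in r_assertions A).
Proof.
rewrite mem_cat; split.
  case/orP=> [/mapP[[B b] h ->]|/flattenP[s /mapP[[[R b] c] h ->]]].
    by left; exists B.
  rewrite !inE => /orP[]/eqP /= ->; right; exists R; [exists c|exists b];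
    by [left|right].
case=> [[B h]|[R [b [h|h]]]]; apply/orP.
- by left; apply/mapP; exists (B, a).
- by right; apply/flattenP; exists [:: a; b]; rewrite ?inE ?eqxx //; apply/mapP;
    exists (R, a, b).
- by right; apply/flattenP; exists [:: b; a]; rewrite ?inE ?eqxx ?orbT //;
    apply/mapP; exists (R, b, a).
Qed.

Lemma chase_hom T A (Y : Type) (M : nstruct Y) (g : iname -> Y) (r : Y) :
  closed_under M (normal_form T) ->
  (forall B a, (B, a) \in c_assertions A -> scon M (Atom B) (g a)) ->
  (forall R a b, (R, a, b) \in r_assertions A -> srole M R (g a) (g b)) ->
  (individuals A = [::] -> sdom M r) ->
  exists h : obj null -> Y, (forall a, h (Named a) = g a) /\
    forall f, chase T A f ->
      preserves M (fun _ => True) (fun _ _ => True) h f.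
Proof.
move=> cl gc gr r0.
pose seed (d : obj null) := match d with
  | Named a => Some (g a) | Anon NullRoot => Some r | _ => None end.
exists (obj_map seed r (some_witness M)); split=> // f [n hf].
apply: (chase_stage_hom (N := normal_form T) (A := A) (n := n)) (hf) => //.
- move=> d R B _ ex; rewrite obj_map_fresh; first exact: some_witnessP.
  by case: d {ex}.
- move=> {hf} f [/r0 h0|a /individualsP h0|B a /gc h0|R a b /gr h0] /= _ //.
  case: h0 => [[B h0]|[R [b [h0|h0]]]].
  - exact: scon_dom (gc _ _ h0).
  - by case: (srole_dom (gr _ _ _ h0)).
  - by case: (srole_dom (gr _ _ _ h0)).
Qed.

(** Only assertions and the creation of nulls produce role facts. This gives the anonymous part its
    forest shape. *)
Lemma chase_stage_role N A n R d e : chase_stage N A n (FRole R d e) ->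
  (exists a b, [/\ d = Named a, e = Named b & (R, a, b) \in r_assertions A]) \/
  (exists B C, e = fresh d R B /\ NExR C R B \in N).
Proof.
elim: n => [|n IH] /= h.
  by left; inversion h; subst; exists a, b.
inversion h; subst; first exact: IH.
by right; exists B, A0; case: H2 => // -[-> -> ->].
Qed.

Lemma chase_stage_named N A n a :
  chase_stage N A n (FDom (Named a)) -> a \in individuals A.
Proof.
elim: n => [|n IH] /= h; first by inversion h.
inversion h; subst; first exact: IH.
by case: H2 => //; case: d {H h H0 H1}.
Qed.

Definition nf_heads (N : seq nf_ci) : seq xname :=
  flatten [seq match ci with
    | NSub _ B | NAnd _ _ B | NExL _ _ B | NTop B | NExR _ _ B | NAllR _ _ B =>
        [:: B]
    | NBot _ => [::] end | ci <- N].

(** A finite list that covers all names in the chase; it bounds the number of types of nulls. *)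
Definition fact_names (N : seq nf_ci) (A : abox) : seq xname :=
  nf_heads N ++ [seq Atom x.1 | x <- c_assertions A].

Lemma chase_stage_fact_names N A n B d :
  chase_stage N A n (FConcept B d) -> B \in fact_names N A.
Proof.
elim: n => [|n IH] /= h; rewrite mem_cat.
  by inversion h; subst; apply/orP; right; apply/mapP; eexists; first eassumption.
inversion h; subst; first by rewrite -mem_cat; exact: IH.
all: apply/orP; left.
all: try by apply/flattenP; exists [:: B]; rewrite ?mem_head //; apply/mapP;
  (eexists; first eassumption).
by case: H2 => // -[-> _]; apply/flattenP; exists [:: B0]; rewrite ?mem_head //;
  apply/mapP; (eexists; first eassumption).
Qed.

(** * The part of the chase below an individual or a null *)

Fixpoint null_base (x : null) : option iname :=
  match x with
  | NullRoot => None
  | NullInd a _ _ => Some a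
  | NullSucc y _ _ => null_base y
  end.

Definition obj_base (d : obj null) : option iname :=
  match d with Named a => Some a | Anon x => null_base x end.

Lemma obj_base_fresh d R B : obj_base (fresh d R B) = obj_base d.
Proof. by case: d. Qed.

Definition fresh_edge (P : obj null -> Prop) (d e : obj null) : Prop :=
  P d /\ exists R B, e = fresh d R B.

(** Only the part below a single individual will matter, so all individuals may share the value
    [r]. *)
Definition below_map (Y : Type) (M : nstruct Y) (r : Y) : obj null -> Y :=
  obj_map (fun d => if d is Named _ then Some r else None) r (some_witness M).

(** Apart from the assertions about [a], this is all that the part of the chase below [a] receives
    from outside. [out] gives the direction of the role assertion. *)
Definition neighbour_derives (N : seq nf_ci) (A : abox) (m : nat)
    (R : rname) (out : bool) (a b : iname) (B : xname) : Prop :=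
  exists C, chase_stage N A m (FConcept C (Named b)) /\
    if out then (R, a, b) \in r_assertions A /\ NExL R C B \in N
    else (R, b, a) \in r_assertions A /\ NAllR C R B \in N.

(** Nulls keep the base of their parent, so whatever enters the part below [a] comes through role
    assertions at [a]. The bound [n] on the stages serves the induction in [unravel_stage]. *)
Lemma chase_hom_below N A a (Y : Type) (M : nstruct Y) (r : Y) n :
  closed_under M N -> (a \in individuals A -> sdom M r) ->
  (forall B, (B, a) \in c_assertions A -> scon M (Atom B) r) ->
  (forall m R out b B, m < n -> neighbour_derives N A m R out a b B ->
    scon M B r) ->
  forall m f, m <= n -> chase_stage N A m f ->
    preserves M (fun d => obj_base d = Some a)
      (fresh_edge (fun d => obj_base d = Some a)) (below_map M r) f.
Proof.
move=> cl ra rc nb; apply: chase_stage_hom => //.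
- by move=> d e [h [R [B ->]]]; rewrite obj_base_fresh.
- move=> d R B _ ex; rewrite /below_map obj_map_fresh; first exact: some_witnessP.
  by case: d {ex}.
- move=> f [//|b hb|B b hb|R b c hb] /=.
  + by case=> eb; apply: ra; rewrite -eb.
  + by case=> eb; apply: rc; rewrite -eb.
  + by case=> _ [S [B]].
- move=> m R C B d e ltmn hN hr hc Pd nK.
  case: (chase_stage_role hr) => [[b [c [eb ec h]]]|[B' [C' [ee _]]]].
    rewrite eb ec /= in Pd hc *; case: Pd => eba; rewrite eba in h.
    by apply: (nb m R true c) => //; exists C.
  by case: nK; split=> //; exists R, B'.
- move=> m R C B d e ltmn hN hc hr Pe nK.
  case: (chase_stage_role hr) => [[b [c [eb ec h]]]|[B' [C' [ee _]]]].
    rewrite eb ec /= in Pe hc *; case: Pe => eca; rewrite eca in h.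
    by apply: (nb m R false b) => //; exists C.
  by case: nK; split; [rewrite ee obj_base_fresh in Pe|exists R, B'].
- by move=> m R C B d _ _ _ _; rewrite obj_base_fresh.
Qed.

Fixpoint null_depth (x : null) : nat :=
  if x is NullSucc y _ _ then (null_depth y).+1 else 0.

Fixpoint subnull (y x : null) : Prop :=
  x = y \/ if x is NullSucc z _ _ then subnull y z else False.

Definition subobj (y : null) (d : obj null) : Prop :=
  if d is Anon x then subnull y x else False.

Lemma subnull_depth y x : subnull y x -> null_depth y <= null_depth x.
Proof.
elim: x => /= [|a R B|z IH R B]; [by case=> // <-|by case=> // <-|].
by case=> [<- //|/IH h]; apply: leqW.
Qed.

Lemma subobj_refl y : subobj y (Anon y).
Proof. by case: y; left. Qed.

Lemma subobj_fresh y d R B : subobj y d -> subobj y (fresh d R B).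
Proof. by case: d => //= x h; right. Qed.

Lemma subobj_freshP y d R B : subobj y (fresh d R B) ->
  fresh d R B = Anon y \/ subobj y d.
Proof. by case: d => [a|x] /= [->|]; auto. Qed.

Lemma fresh_neq_top y d R B : subobj y d -> fresh d R B <> Anon y.
Proof.
by case: d => //= x /subnull_depth h [e]; rewrite -e /= ltnn in h.
Qed.

Definition subtree_map (Y : Type) (M : nstruct Y) (y : null) (r : Y) :
    obj null -> Y :=
  obj_map (fun d => if excluded_middle_informative (d = Anon y) then Some r else None) r
    (some_witness M).

Lemma subtree_map_top (Y : Type) (M : nstruct Y) y r :
  subtree_map M y r (Anon y) = r.
Proof. by apply: obj_map_seed; case: excluded_middle_informative. Qed.

(** Any edge that enters the subtree ends in [y], so whatever comes from outside is a name of [y]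
    itself, and [r] has all of these. *)
Lemma chase_hom_subtree T A y (Y : Type) (M : nstruct Y) (r : Y) f :
  closed_under M (normal_form T) -> sdom M r ->
  (forall B, chase T A (FConcept B (Anon y)) -> scon M B r) ->
  chase T A f ->
  preserves M (subobj y) (fresh_edge (subobj y)) (subtree_map M y r) f.
Proof.
move=> cl rd rc [n hf].
apply: (chase_stage_hom (N := normal_form T) (A := A) (n := n)) (hf) => // {f hf}.
- by move=> d e [h [R [B ->]]]; split=> //; apply: subobj_fresh.
- move=> d R B Pd ex; rewrite /subtree_map obj_map_fresh; first exact: some_witnessP.
  by case: excluded_middle_informative => // eqy; case: (fresh_neq_top Pd eqy).
- move=> f [_ /= h|a _ []|B a _ []|R a b _ [[]]].
  have ey : y = NullRoot by case: h.
  by subst y; rewrite -(subtree_map_top M NullRoot r) in rd.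
- move=> m R C B d e ltmn hN hr hc Pd nK.
  case: (chase_stage_role hr) => [[b [c [eb ec h]]]|[B' [C' [ee _]]]].
    by rewrite eb in Pd.
  by case: nK; split=> //; exists R, B'.
- move=> m R C B d e ltmn hN hc hr Pe nK.
  case: (chase_stage_role hr) => [[b [c [eb ec h]]]|[B' [C' [ee _]]]].
    by rewrite ec in Pe.
  have ey : e = Anon y.
    move: (Pe); rewrite {1}ee => /subobj_freshP[<- //|Pd].
    by case: nK; split=> //; exists R, B'.
  rewrite ey subtree_map_top; apply: rc; exists m.+1; rewrite -ey.
  exact: CS_all hN hc hr.
- move=> m R C B d _ _ _ hB /subobj_freshP[ey|//] _.
  by rewrite ey subtree_map_top; apply: rc; exists m.+1; rewrite -ey.
Qed.

(** * Canonical models are universal *)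

Definition hom_into (X Y : Type) (S : signature) (I : interp X) (J : interp Y)
    (h : obj X -> obj Y) : Prop :=
  [/\ forall d, dom I d -> dom J (h d),
      forall B d, sig_concept S B -> cint I B d -> cint J B (h d)
    & forall R d e, sig_role S R -> rint I R d e -> rint J R (h d) (h e)].

Definition full_sig := Signature (fun _ => True) (fun _ => True).

(** [g] need not be injective: besides the identity, it will be the projection of an unravelling. *)
Lemma canonical_universal T A (X : Type) (I : interp X) (g : iname -> iname) :
  model_tbox I T ->
  (forall B a, (B, a) \in c_assertions A -> cint I B (Named (g a))) ->
  (forall R a b, (R, a, b) \in r_assertions A -> rint I R (Named (g a)) (Named (g b))) ->
  exists h, hom_into full_sig (canonical_model T A) I h /\
    forall a, h (Named a) = Named (g a).
Proof.
move=> IT gc gr; have [r rI] := dom_nonempty I.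
have [h [hg hf]] := @chase_hom T A _ (ext_str I) (fun a => Named (g a)) r
  (ext_str_closed IT) gc gr (fun _ => rI).
exists h; split=> //; split=> [d /hf|B d _ /hf|R d e _ /hf] /=; exact.
Qed.

(** A violation of some A ⊑ ⊥ in the chase would be carried by a homomorphism into a model of the
    KB. *)
Lemma consistent_bot_free T A : consistent T A ->
  bot_free (chase_str T A) (normal_form T).
Proof.
case=> X [I [IT [Ic Ir]]]; have [r rI] := dom_nonempty I.
have [h [_ hf]] := @chase_hom T A _ (ext_str I) Named r
  (ext_str_closed IT) Ic Ir (fun _ => rI).
move=> B d hB hd; apply: (ext_str_bot_free (I := I) (d := h d) hB).
exact: (hf _ hd).
Qed.

Lemma canonical_model_tbox T A : horn T -> consistent T A ->
  model_tbox (canonical_model T A) T.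
Proof. by move=> hT /consistent_bot_free; apply: chase_model_tbox. Qed.

Lemma satisfies_hom (X Y : Type) (S : signature) (I : interp X) (J : interp Y) h q a :
  hom_into S I J h -> sig_cq S q -> (forall b, b \in a -> h (Named b) = Named b) ->
  satisfies I q a -> satisfies J q a.
Proof.
move=> [hd hc hr] [qc qr] hn [pi [pd pa pc pr]]; exists (h \o pi); split.
- by move=> z; apply: hd.
- rewrite (map_comp h) pa -map_comp; apply/eq_in_map => b /hn; exact.
- by move=> B z Bz; apply: hc (pc _ _ Bz); apply: qc Bz.
- by move=> R z z' Rz; apply: hr (pr _ _ _ Rz); apply: qr Rz.
Qed.

Lemma kb_entails_canonical T A q a : horn T -> consistent T A ->
  kb_entails T A q a <-> satisfies (canonical_model T A) q a.
Proof.
move=> hT cT; split=> [h|h X I IT [Ic Ir]].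
  by apply: h; [apply: canonical_model_tbox|apply: canonical_model_abox].
have [k [hk kn]] := canonical_universal (g := id) IT Ic Ir.
by apply: (satisfies_hom hk) h.
Qed.

(** * Finite approximations of homomorphisms *)

Lemma obj_null_comparable : comparable (obj null).
Proof.
have cmp : comparable null.
  by move=> x y; rewrite /decidable; decide equality;
    do ?[exact: concept_comparable|exact: eq_comparable].
by move=> x y; rewrite /decidable; decide equality;
  do ?[exact: cmp|exact: eq_comparable].
Qed.
HB.instance Definition _ := hasDecEq.Build (obj null) (compareP obj_null_comparable).

Lemma uniform_bound (T : eqType) (s : seq T) (Q : nat -> T -> Prop) :
  (forall m n x, m <= n -> Q m x -> Q n x) ->
  (forall x, x \in s -> exists n, Q n x) ->
  exists n, forall x, x \in s -> Q n x.
Proof.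
move=> mono; elim: s => [|x s IH] h; first by exists 0.
have [n hn] := IH (fun y ys => h y (@mem_behead _ (x :: s) y ys)).
have [m hm] := h x (mem_head _ _); exists (maxn m n) => y; rewrite inE.
by case/orP=> [/eqP->|/hn hy]; [apply: mono hm|apply: mono hy];
  rewrite leq_max leqnn ?orbT.
Qed.

(** If each of the finitely many candidates failed at some [n], all would fail at a common bound.
    This is the compactness argument that passes from all finite depths to infinite depth. *)
Lemma antitone_pigeonhole (T : eqType) (s : seq T) (P : nat -> T -> Prop) :
  (forall m n x, m <= n -> P n x -> P m x) ->
  (forall n, exists2 x, x \in s & P n x) ->
  exists2 x, x \in s & forall n, P n x.
Proof.
move=> anti ex; apply: NNPP => no.
have [n hn] : exists n, forall x, x \in s -> ~ P n x.
  apply: uniform_bound => [m n x lemn h /(anti _ _ _ lemn) //|x xs].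
  by apply: not_all_ex_not => h; apply: no; exists x.
by have [x xs] := ex n; exact: hn.
Qed.

(** Splitting by one name of [L] at a time leaves at most one representative for each subset of
    [L]. *)
Lemma type_representatives (Y : eqType) (t : Y -> xname -> Prop) (L : seq xname)
    (Q : Y -> Prop) :
  exists K : seq Y, (forall e, e \in K -> Q e) /\
    forall e, Q e -> exists2 e0, e0 \in K & forall B, B \in L -> t e B -> t e0 B.
Proof.
elim: L Q => [|B L IH] Q.
  have [[e Qe]|no] := classic (exists e, Q e); last first.
    by exists [::]; split=> // e Qe; case: no; exists e.
  by exists [:: e]; split=> [x|x _]; [rewrite inE => /eqP->|exists e; rewrite ?mem_head].
have [K1 [h1 k1]] := IH (fun e => Q e /\ t e B).
have [K2 [h2 k2]] := IH (fun e => Q e /\ ~ t e B).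
exists (K1 ++ K2); split=> [e|e Qe].
  by rewrite mem_cat => /orP[/h1[]|/h2[]].
have [tB|ntB] := classic (t e B).
  have [e0 e0K h] := k1 e (conj Qe tB); exists e0; first by rewrite mem_cat e0K.
  move=> C; rewrite inE => /orP[/eqP-> _|/h //]; by case: (h1 _ e0K).
have [e0 e0K h] := k2 e (conj Qe ntB); exists e0; first by rewrite mem_cat e0K orbT.
by move=> C; rewrite inE => /orP[/eqP->|/h].
Qed.

Lemma filter_prop (T : eqType) (s : seq T) (P : T -> Prop) :
  exists s' : seq T, forall x, x \in s' <-> x \in s /\ P x.
Proof.
elim: s => [|y s [s' IH]]; first by exists [::] => x; split=> // -[].
have [Py|nPy] := classic (P y); [exists (y :: s')|exists s'] => x; rewrite !inE.
  split; first by case/orP=> [/eqP->|/IH[-> h]]; rewrite ?eqxx ?orbT.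
  by case=> /orP[/eqP->|xs] h; rewrite ?eqxx //; apply/orP; right; apply/IH.
split; first by case/IH=> -> h; rewrite orbT.
by case=> /orP[/eqP->|xs] h //; apply/IH.
Qed.

(* [sim n x e]: the part of depth [n] below [x] of the canonical model of [T2] maps into
   that of [T1], with [x] sent to [e]. *)
Fixpoint sim (T1 T2 : tbox) (A : abox) (S : signature) (n : nat) (x e : obj null) : Prop :=
  (forall B, sig_concept S B -> chase T2 A (FConcept (Atom B) x) ->
    chase T1 A (FConcept (Atom B) e)) /\
  if n is m.+1 then
    forall R B, chase T2 A (FRole R x (fresh x R B)) ->
    exists e', [/\ chase T1 A (FDom e'), sig_role S R -> chase T1 A (FRole R e e')
                 & sim T1 T2 A S m (fresh x R B) e']
  else True.

Lemma sim_le T1 T2 A S m n x e :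
  m <= n -> sim T1 T2 A S n x e -> sim T1 T2 A S m x e.
Proof.
elim: n m x e => [|n IH] [|m] x e //= lemn [h1 h2]; split=> // R B /h2[e' [h3 h4 h5]].
by exists e'; split=> //; apply: IH h5.
Qed.

(** By [chase_hom_subtree], the subtree at [y] maps into the chase with [y] sent to [r]; composing
    with this map moves the simulation. *)
Lemma sim_subtree T1 T2 A S n x y r :
  chase T1 A (FDom r) ->
  (forall B, chase T1 A (FConcept B (Anon y)) -> chase T1 A (FConcept B r)) ->
  sim T1 T2 A S n x (Anon y) -> sim T1 T2 A S n x r.
Proof.
move=> rd rc; pose k := subtree_map (chase_str T1 A) y r.
have hk f : chase T1 A f -> preserves (chase_str T1 A) (subobj y) (fresh_edge (subobj y)) k f.
  exact: chase_hom_subtree (@chase_closed T1 A) rd rc.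
suff gen e : subobj y e -> sim T1 T2 A S n x e -> sim T1 T2 A S n x (k e).
  by move/(gen _ (subobj_refl y)); rewrite /k subtree_map_top.
elim: n x e => [|n IH] x e ye [h1 h2]; split=> //.
- by move=> B SB /h1-/(_ SB)/hk; apply.
- by move=> B SB /h1-/(_ SB)/hk; apply.
move=> R B /h2[e' [e'd hr hs]].
(* Along a role in [S] the target is a successor of [e] and stays in the subtree. Along any other
   role it may lie outside, but then it can stay where it is. *)
have [SR|nSR] := classic (sig_role S R); last by exists e'; split=> // /nSR.
have hre := hr SR.
have [B' ee'] : exists B', e' = fresh e R B'.
  case: (hre) => m /chase_stage_role[[a [b [ea _ _]]]|[B' [C [-> _]]]]; last by exists B'.
  by rewrite ea in ye.
have ye' : subobj y e' by rewrite ee'; apply: subobj_fresh.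
exists (k e'); split; [exact: (hk _ e'd)| |exact: IH].
by move=> _; apply: (hk _ hre); split=> //; exists R, B'.
Qed.

(** Individuals represent themselves; for nulls, one representative per type is enough by
    [sim_subtree]. *)
Lemma sim_representatives T1 T2 A S : exists K : seq (obj null),
  (forall e, e \in K -> chase T1 A (FDom e)) /\
  forall e, chase T1 A (FDom e) -> exists2 e0, e0 \in K &
    forall n x, sim T1 T2 A S n x e -> sim T1 T2 A S n x e0.
Proof.
have [K [K1 K2]] := type_representatives (fun e B => chase T1 A (FConcept B e))
  (fact_names (normal_form T1) A)
  (fun e => chase T1 A (FDom e) /\ exists y, e = Anon y).
exists ([seq Named a | a <- individuals A] ++ K); split=> [e|[a|y] he].
- rewrite mem_cat => /orP[/mapP[a ha ->]|/K1[]] //.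
  by apply: chase_abox; apply: AF_ind.
- exists (Named a) => //; rewrite mem_cat; apply/orP; left; apply: map_f.
  by case: he => n /chase_stage_named.
have [|e0 e0K h] := K2 (Anon y); first by split=> //; exists y.
exists e0; first by rewrite mem_cat e0K orbT.
move=> n x; apply: sim_subtree; first by case: (K1 _ e0K).
move=> B hB; apply: h => //; case: hB => m; exact: chase_stage_fact_names.
Qed.

Definition exr_pairs (N : seq nf_ci) : seq (rname * xname) :=
  pmap (fun ci => if ci is NExR _ R B then Some (R, B) else None) N.

Lemma mem_exr_pairs N C R B : NExR C R B \in N -> (R, B) \in exr_pairs N.
Proof. by move=> h; rewrite mem_pmap; apply/mapP; exists (NExR C R B). Qed.

Definition successors (N : seq nf_ci) (A : abox) (d : obj null) : seq (obj null) :=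
  [seq Named x.2 | x <- r_assertions A] ++ [seq fresh d RB.1 RB.2 | RB <- exr_pairs N].

Lemma mem_successors T A R d e :
  chase T A (FRole R d e) -> e \in successors (normal_form T) A d.
Proof.
case=> n /chase_stage_role h; rewrite mem_cat; apply/orP.
case: h => [[a [b [-> -> h]]]|[B [C [-> /mem_exr_pairs h]]]].
  by left; apply/mapP; exists (R, a, b).
by right; apply/mapP; exists (R, B).
Qed.

(** The target may vary with the depth, but it lies in, or can be moved into, a finite set: the
    successors of [e] if [R] is in [S], the representatives otherwise. [antitone_pigeonhole] then
    yields one target for all depths. *)
Lemma sim_step T1 T2 A S x e R B : (forall n, sim T1 T2 A S n x e) ->
  chase T2 A (FRole R x (fresh x R B)) ->
  exists e', [/\ chase T1 A (FDom e'), sig_role S R -> chase T1 A (FRole R e e')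
               & forall n, sim T1 T2 A S n (fresh x R B) e'].
Proof.
move=> hs hr; have {}hs n : exists e', [/\ chase T1 A (FDom e'),
    sig_role S R -> chase T1 A (FRole R e e') & sim T1 T2 A S n (fresh x R B) e'].
  by case: (hs n.+1) => _ /(_ R B hr).
have [SR|nSR] := classic (sig_role S R).
  have [|n|e' _ h] := @antitone_pigeonhole _ (successors (normal_form T1) A e)
      (fun n e' => chase T1 A (FRole R e e') /\ sim T1 T2 A S n (fresh x R B) e').
  - by move=> m n e' lemn [h1 h2]; split=> //; apply: sim_le h2.
  - have [e' [h1 h2 h3]] := hs n; have {}h2 := h2 SR.
    by exists e' => //; apply: mem_successors h2.
  exists e'; split; last by move=> n; case: (h n).
    by case: (h 0) => /chase_role_dom[].
  by case: (h 0).
have [K [K1 K2]] := sim_representatives T1 T2 A S.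
have [|n|e' /K1 h1 h2] := @antitone_pigeonhole _ K
    (fun n e' => sim T1 T2 A S n (fresh x R B) e').
- by move=> m n e' lemn; apply: sim_le.
- by have [e' [/K2[e0 e0K h] _ /h]] := hs n; exists e0.
by exists e'; split.
Qed.

Lemma sim_root T1 T2 A S x :
  (forall n, exists2 e, chase T1 A (FDom e) & sim T1 T2 A S n x e) ->
  exists2 e, chase T1 A (FDom e) & forall n, sim T1 T2 A S n x e.
Proof.
have [K [K1 K2]] := sim_representatives T1 T2 A S => hs.
have [|n|e /K1 h1 h2] := @antitone_pigeonhole _ K (fun n e => sim T1 T2 A S n x e).
- by move=> m n e lemn; apply: sim_le.
- by have [e /K2[e0 e0K h] /h] := hs n; exists e0.
by exists e.
Qed.

Lemma chase_role_fresh T A R B d : chase T A (FRole R d (fresh d R B)) ->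
  (R, B) \in exr_pairs (normal_form T).
Proof.
case=> n /chase_stage_role[[a [b [-> //]]]|[B' [C [e /mem_exr_pairs]]]].
by suff -> : B = B' by []; case: d e => [a|y] /= [].
Qed.

(** Individuals are fixed, and the map continues to each fresh null by choosing a target from
    [sim_step]. Simulation of every depth is the invariant that lets the choice go on. *)
Lemma sim_hom_embeddable T1 T2 A S :
  (forall a n, a \in individuals A -> sim T1 T2 A S n (Named a) (Named a)) ->
  (individuals A = [::] -> forall n, exists2 e, chase T1 A (FDom e) &
    sim T1 T2 A S n (Anon NullRoot) e) ->
  hom_embeddable S A (canonical_model T2 A) (canonical_model T1 A).
Proof.
move=> sN sR.
(* [NullRoot] is present for the empty ABox only, so [r] is arbitrary otherwise. *)
have [r hr] : exists r, individuals A = [::] -> chase T1 A (FDom r) /\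
    forall n, sim T1 T2 A S n (Anon NullRoot) r.
  have [e0|ne] := classic (individuals A = [::]); last by exists (Anon NullRoot).
  by have [r r1 r2] := sim_root (sR e0); exists r.
pose good x R B e e' := [/\ chase T1 A (FDom e'), sig_role S R -> chase T1 A (FRole R e e')
               & forall n, sim T1 T2 A S n (fresh x R B) e'].
pose h := obj_map (fun d => match d with
  | Named a => Some (Named a) | Anon NullRoot => Some r | _ => None end) r
  (fun x e R B => epsilon (inhabits e) (good x R B e)).
have hfresh x R B : (forall n, sim T1 T2 A S n x (h x)) ->
    chase T2 A (FRole R x (fresh x R B)) -> good x R B (h x) (h (fresh x R B)).
  move=> h1 h2; rewrite {2}/h obj_map_fresh; last by case: x {h1 h2}.
  by apply: epsilon_spec; apply: sim_step.
have inv m x : chase_stage (normal_form T2) A m (FDom x) ->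
    chase T1 A (FDom (h x)) /\ forall n, sim T1 T2 A S n x (h x).
  elim: m x => [|m IH] x hx.
    inversion hx; subst; first exact: hr.
    by split=> [|n]; [apply: chase_abox; apply: AF_ind|apply: sN].
  inversion hx; subst; first exact: IH.
  case: H2 => // -[->]; have [_ hs] := IH _ (chase_stage_dom H0).
  have [//|g1 _ g3] := @hfresh d R B hs _; last by [].
  by exists m.+1; apply: (CS_exr H H0 H1); constructor 2.
exists h; split=> //.
- by move=> d [m /inv[]].
- move=> B d SB hB; have [m /inv[_ /(_ 0)[h1 _]]] := chase_con_dom hB.
  exact: h1.
- move=> R d e SR hR; case: (hR) => n /chase_stage_role.
  case=> [[a [b [-> -> h1]]]|[B [C [ee _]]]].
    by apply: chase_abox; apply: AF_role.
  rewrite ee in hR *; have [[m /inv[_ hs]] _] := chase_role_dom hR.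
  by have [_ /(_ SR)] := hfresh _ _ _ hs hR.
Qed.

(** * From CQ entailment to an embedding *)

Fixpoint descendants (N : seq nf_ci) (n : nat) (x : obj null) : seq (obj null) :=
  x :: if n is m.+1 then
    flatten [seq descendants N m (fresh x RB.1 RB.2) | RB <- exr_pairs N]
  else [::].

(* Apply the entailment to the CQ that describes [L] in the canonical model of [T2]. *)
Lemma cq_entails_finite_hom T1 T2 Theta A (L : seq (obj null)) :
  horn T1 -> horn T2 -> cq_entails Theta T1 T2 -> sig_abox Theta.1 A ->
  consistent T1 A -> consistent T2 A ->
  exists k : obj null -> obj null,
  [/\ forall d, chase T1 A (FDom (k d)),
      forall B d, sig_concept Theta.2 B -> d \in L ->
        chase T2 A (FConcept (Atom B) d) -> chase T1 A (FConcept (Atom B) (k d)),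
      forall R d e, sig_role Theta.2 R -> d \in L -> e \in L ->
        chase T2 A (FRole R d e) -> chase T1 A (FRole R (k d) (k e))
    & forall a, a \in individuals A -> Named a \in L -> k (Named a) = Named a].
Proof.
move=> hT1 hT2 ent sA c1 c2.
pose N := normal_form T2.
pose names := pmap (fun B => if B is Atom B' then Some B' else None) (fact_names N A).
pose roles := [seq x.1.1 | x <- r_assertions A] ++ [seq RB.1 | RB <- exr_pairs N].
(* Elements of [L] become variables through their position in [L]. *)
pose v (d : obj null) : var := index d L.
have [cs hcs] := filter_prop [seq (B, d) | B <- names, d <- L]
  (fun x => sig_concept Theta.2 x.1 /\ chase T2 A (FConcept (Atom x.1) x.2)).
have [rs hrs] := filter_prop [seq (Rd, e) | Rd <- [seq (R, d) | R <- roles, d <- L], e <- L]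
  (fun x => sig_role Theta.2 x.1.1 /\ chase T2 A (FRole x.1.1 x.1.2 x.2)).
(* The individuals in [L] become answer variables, which forces the match for [T1] to fix them. *)
pose an := [seq a <- individuals A | Named a \in L].
pose q := CQ [seq v (Named a) | a <- an] [seq (x.1, v x.2) | x <- cs]
  [seq (x.1.1, v x.1.2, v x.2) | x <- rs].
have [d0 hd0] := chase_nonempty T2 A.
have qS : sig_cq Theta.2 q.
  split=> [B z /mapP[x /hcs[_ [h _]]] [-> _] //|R z z' /mapP[x /hrs[_ [h _]]] [-> _ _] //].
have q2 : satisfies (canonical_model T2 A) q an.
  (* [satisfies] wants a domain element for every variable, while [L] may contain objects outside
     the chase; these are replaced by [d0]. *)
  pose pi z := if excluded_middle_informative (chase T2 A (FDom (nth d0 L z)))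
    then nth d0 L z else d0.
  have piv d : d \in L -> chase T2 A (FDom d) -> pi (v d) = d.
    by move=> dL hd; rewrite /pi /v nth_index //; case: excluded_middle_informative.
  exists pi; split.
  - by move=> z; rewrite /pi; case: excluded_middle_informative.
  - rewrite -map_comp; apply/eq_in_map => a; rewrite mem_filter => /andP[aL aA].
    by apply: piv => //; apply: chase_abox; apply: AF_ind.
  - move=> B z /mapP[[B' d] /hcs[/allpairsP[[B1 d1] [/= _ dL [-> e2]]] [_ h]] [-> ->]] /=.
    by rewrite /= e2 in h *; rewrite piv //; apply: chase_con_dom h.
  - move=> R z z' /mapP[[[R' d] e] /hrs[/allpairsP[[[R1 d1] e1] [/=]]]].
    case/allpairsP=> -[R2 d2] [/= _ dL [-> ->]] eL [-> -> ->] [_ /= h] [-> -> ->].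
    by have [h1 h2] := chase_role_dom h; rewrite !piv.
have [pi [pd pa pc pr]] : satisfies (canonical_model T1 A) q an.
  apply/kb_entails_canonical => //; apply: ent => //.
  - by rewrite !size_map.
  - by move=> b; rewrite mem_filter => /andP[].
  - exact/kb_entails_canonical.
exists (pi \o v); split=> /=.
- by move=> d; apply: pd.
- move=> B d SB dL hB; apply: pc; apply/mapP; exists (B, d) => //.
  apply/hcs; split=> //; apply/allpairsP; exists (B, d); split=> //=.
  rewrite mem_pmap; apply/mapP; exists (Atom B) => //.
  by case: hB => n; apply: chase_stage_fact_names.
- move=> R d e SR dL eL hR; apply: pr; apply/mapP; exists (R, d, e) => //.
  apply/hrs; split=> //; apply/allpairsP; exists ((R, d), e); split=> //=.
  apply/allpairsP; exists (R, d); split=> //=; rewrite mem_cat; apply/orP.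
  case: hR => n /chase_stage_role[[a [b [_ _ h]]]|[B [C [_ /mem_exr_pairs h]]]].
    by left; apply/mapP; exists (R, a, b).
  by right; apply/mapP; exists (R, B).
- move=> a aA aL; have : a \in an by rewrite mem_filter aL.
  move: pa; rewrite /q /= -map_comp => /eq_in_map; exact.
Qed.

Lemma finite_hom_sim T1 T2 A S (k : obj null -> obj null) n x :
  (forall d, chase T1 A (FDom (k d))) ->
  (forall B d, sig_concept S B -> d \in descendants (normal_form T2) n x ->
    chase T2 A (FConcept (Atom B) d) -> chase T1 A (FConcept (Atom B) (k d))) ->
  (forall R d e, sig_role S R -> d \in descendants (normal_form T2) n x ->
    e \in descendants (normal_form T2) n x ->
    chase T2 A (FRole R d e) -> chase T1 A (FRole R (k d) (k e))) ->
  sim T1 T2 A S n x (k x).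
Proof.
move=> kd; elim: n x => [|n IH] x kc kr.
  by split=> // B SB; apply: kc => //; apply: mem_head.
split=> [B SB|R B hR]; first by apply: kc => //; apply: mem_head.
have sub d : d \in descendants (normal_form T2) n (fresh x R B) ->
    d \in descendants (normal_form T2) n.+1 x.
  move=> h; rewrite /= inE; apply/orP; right; apply/flattenP; eexists; last exact: h.
  by apply/mapP; exists (R, B) => //; apply: chase_role_fresh hR.
exists (k (fresh x R B)); split=> //.
  move=> SR; apply: kr => //; first exact: mem_head.
  by apply: sub; case: (n) => [|m]; apply: mem_head.
apply: IH => [C d SC /sub|R' d e SR' /sub dL /sub eL]; first exact: kc.
exact: kr.
Qed.

Lemma cq_entails_hom_embeddable T1 T2 Theta A :
  horn T1 -> horn T2 -> cq_entails Theta T1 T2 -> sig_abox Theta.1 A ->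
  consistent T1 A -> consistent T2 A ->
  hom_embeddable Theta.2 A (canonical_model T2 A) (canonical_model T1 A).
Proof.
move=> hT1 hT2 ent sA c1 c2.
have sims n x : exists k, [/\ forall d, chase T1 A (FDom (k d)),
    sim T1 T2 A Theta.2 n x (k x)
    & forall a, a \in individuals A -> x = Named a -> k x = Named a].
  have [k [kd kc kr kn]] := cq_entails_finite_hom
    (descendants (normal_form T2) n x) hT1 hT2 ent sA c1 c2.
  exists k; split=> //; first exact: finite_hom_sim.
  move=> a aA ex; rewrite ex; apply: kn => //; rewrite ex.
  by case: (n) => [|m]; apply: mem_head.
apply: sim_hom_embeddable => [a n aA|_ n].
  by have [k [_ + /(_ a aA erefl) ek]] := sims n (Named a); rewrite ek.
by have [k [h1 h2 _]] := sims n (Anon NullRoot); exists (k (Anon NullRoot)).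
Qed.

(** * Finite trees as ABoxes *)

(** An undirected graph contained in a rooted forest with depth [dp] and parent [par]. *)
Definition parent_graph (e : rel nat) (dp par : nat -> nat) : Prop :=
  forall x y, e x y ->
    (dp y = (dp x).+1 /\ par y = x) \/ (dp x = (dp y).+1 /\ par x = y).

Lemma seq_argmax (s : seq nat) (dp : nat -> nat) : s != [::] ->
  exists2 m, m \in s & forall x, x \in s -> dp x <= dp m.
Proof.
elim: s => [//|y [|z s] IH] _.
  by exists y; rewrite ?mem_head // => x; rewrite inE => /eqP->.
have [//|m ms hm] := IH; have [le|lt] := leqP (dp y) (dp m).
  exists m; first by rewrite inE ms orbT.
  by move=> x; rewrite inE => /orP[/eqP->|/hm].
exists y; rewrite ?mem_head // => x; rewrite inE => /orP[/eqP->//|/hm h].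
exact: leq_trans h (ltnW lt).
Qed.

(* In a cycle, both neighbours of a vertex of maximal depth are its parent. *)
Lemma parent_graph_acyclic e dp par : parent_graph e dp par ->
  forall c, 2 < size c -> ~ ucycle e c.
Proof.
move=> pg c c2 uc; have cn : c != [::] by case: (c) c2.
have [m mc hm] := seq_argmax dp cn.
have [i s es] := rot_to mc.
have us : ucycle e (m :: s) by rewrite -es /ucycle /ucycleb rot_cycle rot_uniq.
have {}hm x : x \in m :: s -> dp x <= dp m.
  by move=> xs; apply: hm; rewrite -(mem_rot i) es.
have {c2} : 2 < size (m :: s) by rewrite -es size_rot.
case/lastP: s us hm {es} => [//|s z]; case: s => [//|x s] us hm _.
move: us; rewrite /ucycle /ucycleb rcons_cons => /andP[/=].
rewrite rcons_path last_rcons => /andP[emx /andP[_ ezm]] /andP[_ /andP[+ _]].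
have hx : dp x <= dp m by apply: hm; rewrite !inE eqxx orbT.
have hz : dp z <= dp m by apply: hm; rewrite rcons_cons !inE mem_rcons mem_head !orbT.
have [[h _]|[_ ex]] := pg _ _ emx; first by rewrite h ltnn in hx.
have [[_ ez]|[h _]] := pg _ _ ezm; last by rewrite h ltnn in hz.
by rewrite -ex ez mem_rcons mem_head.
Qed.

(** A simple path that starts at depth 0 only descends, since a step up after a step down would
    return to the previous vertex. *)
Lemma parent_graph_path e dp par r p a : parent_graph e dp par -> dp r = 0 ->
  path e r (rcons p a) -> uniq (r :: rcons p a) ->
  par a = last r p.
Proof.
move=> pg r0; elim/last_ind: p a => [|p u IH] a.
  move=> /= /andP[era _] _; have [[_ ->] //|[h _]] := pg _ _ era.
  by rewrite r0 in h.
rewrite rcons_path last_rcons => /andP[hp eua]; rewrite -rcons_cons rcons_uniq.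
case/andP=> nin un; have pu := IH _ hp un.
have [[_ ->] //|[_ h]] := pg _ _ eua.
by rewrite -h pu -rcons_cons mem_rcons inE mem_last orbT in nin.
Qed.

(** If the neighbour [b] were the parent of [a], it would lie on the simple path from [r] to [a]. *)
Lemma parent_graph_child A dp par r a b : parent_graph (edge A) dp par -> dp r = 0 ->
  child A r a b -> edge A a b /\ par b = a.
Proof.
move=> pg r0 [p [hp un la eab nb]]; split=> //.
have [[_ ->] //|[da pa]] := pg _ _ eab.
case/lastP: p hp un la nb => [|p c] hp un la nb.
  by rewrite -la /= r0 in da.
rewrite last_rcons in la; rewrite la in hp un nb.
have pa' := parent_graph_path pg r0 hp un.
by rewrite -pa pa' -rcons_cons mem_rcons inE mem_last orbT in nb.
Qed.

Lemma edge_sym A x y : edge A x y = edge A y x.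
Proof. by rewrite /edge; apply: eq_has => z; rewrite orbC. Qed.

(* A step [(R, out, b)] leads to [b] along [R], forwards if [out] holds and backwards
   otherwise; nodes of the tree are addressed by their sequence of child indices,
   the last one first. *)
Definition step := (rname * bool * iname)%type.
Definition step0 : step := (0, true, 0).

(** The individual of the original ABox of which the node [w] is a copy. *)
Fixpoint tlabel (cs : iname -> seq step) (a : iname) (w : seq nat) : iname :=
  if w is i :: w' then (nth step0 (cs (tlabel cs a w')) i).2 else a.

Fixpoint tvalid (cs : iname -> seq step) (a : iname) (w : seq nat) : bool :=
  if w is i :: w' then (i < size (cs (tlabel cs a w'))) && tvalid cs a w' else true.

Fixpoint tlevel (cs : iname -> seq step) (a : iname) (l : nat) : seq (seq nat) :=
  if l is m.+1 then
    flatten [seq [seq i :: w | i <- iota 0 (size (cs (tlabel cs a w)))]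
            | w <- tlevel cs a m]
  else [:: [::]].

Definition taddr (cs : iname -> seq step) (a : iname) (n : nat) : seq (seq nat) :=
  flatten [seq tlevel cs a l | l <- iota 0 n.+1].

Lemma mem_tlevel cs a l w :
  (w \in tlevel cs a l) = (size w == l) && tvalid cs a w.
Proof.
elim: l w => [|l IH] w /=; first by case: w.
apply/flattenP/idP => [[s /mapP[v]]|].
  rewrite IH => /andP[/eqP sv vv] -> /mapP[i]; rewrite mem_iota => /andP[_ hi] -> /=.
  by rewrite sv eqxx hi.
case: w => [//|i w] /= /andP[/eqP[sw] /andP[hi vw]].
exists [seq j :: w | j <- iota 0 (size (cs (tlabel cs a w)))].
  by apply: map_f; rewrite IH sw eqxx.
by apply: map_f; rewrite mem_iota.
Qed.

Lemma mem_taddr cs a n w :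
  (w \in taddr cs a n) = (size w <= n) && tvalid cs a w.
Proof.
apply/flattenP/idP => [[s /mapP[l]]|/andP[sw vw]].
  by rewrite mem_iota => /andP[_ hl] ->; rewrite mem_tlevel => /andP[/eqP-> ->]; rewrite andbT.
exists (tlevel cs a (size w)); last by rewrite mem_tlevel eqxx.
by apply: map_f; rewrite mem_iota.
Qed.

(** Individual names are numbers, so addresses are coded. *)
Definition node (w : seq nat) : iname := pickle w.
Definition node_address (x : iname) : seq nat := odflt [::] (unpickle x).

Lemma nodeK : cancel node node_address.
Proof. by move=> w; rewrite /node_address /node pickleK. Qed.

Lemma node_inj : injective node.
Proof. exact: can_inj nodeK. Qed.

Definition tassertion (cs : iname -> seq step) (a : iname) (w : seq nat) :
    seq (rname * iname * iname) :=
  if w is i :: w' then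
    let st := nth step0 (cs (tlabel cs a w')) i in
    [:: if st.1.2 then (st.1.1, node w', node w) else (st.1.1, node w, node w')]
  else [::].

Definition tabox (A : abox) (cs : iname -> seq step) (a : iname) (n : nat) : abox :=
  ABox (flatten [seq [seq (x.1, node w) | x <- c_assertions A & x.2 == tlabel cs a w]
                | w <- taddr cs a n])
       (flatten [seq tassertion cs a w | w <- taddr cs a n]).

Lemma tabox_concept A cs a n B x : (B, x) \in c_assertions (tabox A cs a n) <->
  exists w, [/\ w \in taddr cs a n, x = node w & (B, tlabel cs a w) \in c_assertions A].
Proof.
split=> [/flattenP[s /mapP[w hw ->] /mapP[[B' b]]]|[w [hw -> hB]]].
  by rewrite mem_filter /= => /andP[/eqP-> h] [-> ->]; exists w.
apply/flattenP; eexists; first by apply: map_f hw.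
by apply/mapP; exists (B, tlabel cs a w); rewrite ?mem_filter ?eqxx.
Qed.

Lemma tabox_role A cs a n R x y : (R, x, y) \in r_assertions (tabox A cs a n) <->
  exists i w, [/\ i :: w \in taddr cs a n,
    (nth step0 (cs (tlabel cs a w)) i).1.1 = R &
    if (nth step0 (cs (tlabel cs a w)) i).1.2 then x = node w /\ y = node (i :: w)
    else x = node (i :: w) /\ y = node w].
Proof.
split=> [/flattenP[s /mapP[[|i w] hw ->]] //=|[i [w [hw hR hxy]]]].
  rewrite inE => /eqP e; exists i, w; move: e.
  by case: (nth _ _ _).1.2 => -[-> -> ->]; split.
apply/flattenP; exists (tassertion cs a (i :: w)); first exact: map_f.
rewrite inE hR; apply/eqP; move: hxy.
by case: (nth _ _ _).1.2 => -[-> ->].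
Qed.

Lemma tabox_edge A cs a n x y : edge (tabox A cs a n) x y <->
  exists i w, i :: w \in taddr cs a n /\
    ((x = node w /\ y = node (i :: w)) \/ (x = node (i :: w) /\ y = node w)).
Proof.
split.
  case/hasP=> -[[R u] v] /tabox_role[i [w [hw _ huv]]] /= hxy; exists i, w; split=> //.
  move: huv hxy; case: (nth _ _ _).1.2 => -[-> ->] /orP[]/andP[/eqP<- /eqP<-]; auto.
case=> i [w [hw hxy]]; apply/hasP.
pose st := nth step0 (cs (tlabel cs a w)) i.
exists (if st.1.2 then (st.1.1, node w, node (i :: w)) else (st.1.1, node (i :: w), node w)).
  by case e: st.1.2; apply/tabox_role; exists i, w; split=> //; rewrite -/st e.
by case: st.1.2; case: hxy => -[-> ->]; rewrite /= !eqxx ?orbT.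
Qed.

Lemma tabox_individual A cs a n x : x \in individuals (tabox A cs a n) ->
  exists2 w, w \in taddr cs a n & x = node w.
Proof.
have up i w : i :: w \in taddr cs a n -> w \in taddr cs a n.
  by rewrite !mem_taddr /= => /andP[/ltnW-> /andP[_ ->]].
case/individualsP=> [[B /tabox_concept[w [hw -> _]]]|[R [y hy]]]; first by exists w.
have [i [w [hw hxy]]] : exists i w, i :: w \in taddr cs a n /\ (x = node w \/ x = node (i :: w)).
  case: hy => /tabox_role[i [w [hw _]]]; exists i, w; split=> //;
    move: p; case: (nth _ _ _).1.2 => -[]; auto.
by case: hxy => ->; [exists w => //; apply: up hw|exists (i :: w)].
Qed.

Lemma tabox_parent_graph A cs a n : parent_graph (edge (tabox A cs a n))
  (fun x => size (node_address x)) (fun x => node (behead (node_address x))).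
Proof. by move=> x y /tabox_edge[i [w [_ [[-> ->]|[-> ->]]]]]; rewrite !nodeK; auto. Qed.

Lemma tabox_tree_shaped A cs a n : tree_shaped (tabox A cs a n).
Proof.
set A' := tabox A cs a n; split.
- have conn w : w \in taddr cs a n ->
      (exists p, path (edge A') (node [::]) p /\ last (node [::]) p = node w) /\
      (exists p, path (edge A') (node w) p /\ last (node w) p = node [::]).
    elim: w => [|i w IH] hw; first by split; exists [::].
    have hw' : w \in taddr cs a n.
      by move: hw; rewrite !mem_taddr /= => /andP[/ltnW-> /andP[_ ->]].
    have ew : edge A' (node w) (node (i :: w)).
      by apply/tabox_edge; exists i, w; split=> //; left.
    have [[p [hp lp]] [p' [hp' lp']]] := IH hw'; split.
      by exists (rcons p (node (i :: w))); rewrite rcons_path last_rcons hp lp.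
    by exists (node w :: p'); rewrite /= edge_sym ew.
  move=> x y /tabox_individual[w hw ->] /tabox_individual[v hv ->].
  have [_ [p [hp lp]]] := conn _ hw; have [[p' [hp' lp']] _] := conn _ hv.
  by exists (p ++ p'); rewrite cat_path last_cat hp lp.
- exact: parent_graph_acyclic (@tabox_parent_graph A cs a n).
(* Two assertions on the same pair of nodes come from the same child, as otherwise a node would be
   its own grandchild. *)
- have loop (i j : nat) w : w = j :: i :: w -> False.
    by move/(congr1 size) => /= /eqP; rewrite ltn_eqF.
  move=> R x y /tabox_role[i [w [hw hR hxy]]]; split=> S.
    move=> SR; apply/negP => /tabox_role[j [v [hv hS hxy']]]; apply: SR.
    have [e1 e2] : i = j /\ w = v.
      move: hxy hxy'; case: (nth _ _ i).1.2 => -[-> ->];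
        case: (nth _ _ j).1.2 => -[/node_inj e1 /node_inj e2].
      + by case: e2.
      + by rewrite -e2 in e1; case: (loop i j w).
      + by rewrite -e1 in e2; case: (loop i j w).
      + by case: e1.
    by rewrite -hS -hR e1 e2.
  apply/negP => /tabox_role[j [v [hv hS]]]; move: hxy.
  case ei: (nth _ _ i).1.2 => -[-> ->]; case ej: (nth _ _ j).1.2;
    case=> /node_inj e1 /node_inj e2.
  + by rewrite -e1 in e2; case: (loop i j w).
  + by move: ei ej; case: e1 => -> ->; move=> ->.
  + by move: ei ej; case: e2 => -> ->; move=> ->.
  + by rewrite -e2 in e1; case: (loop i j w).
Qed.

Lemma tabox_outdegree A cs a n k : (forall b, size (cs b) <= k) ->
  node [::] \in individuals (tabox A cs a n) -> outdegree_le (tabox A cs a n) k.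
Proof.
move=> hk hr; right; exists (node [::]) => // x s /tabox_individual[w hw ->] us hs.
apply: leq_trans (hk (tlabel cs a w)).
suff /(uniq_leq_size us) :
    {subset s <= [seq node (i :: w) | i <- iota 0 (size (cs (tlabel cs a w)))]}.
  by rewrite size_map size_iota.
move=> b /hs hb.
have [|e pb] := parent_graph_child (@tabox_parent_graph A cs a n) _ hb.
  by rewrite nodeK.
have [j [v [hv [[e1 e2]|[e1 e2]]]]] := (tabox_edge A cs a n (node w) b).1 e.
  move/node_inj: e1 => e1; rewrite e2 -e1; apply: (map_f (fun i => node (i :: w))).
  by move: hv; rewrite -e1 mem_taddr mem_iota /= => /andP[_ /andP[]].
move: pb; rewrite e2 nodeK => /node_inj/(congr1 size); rewrite size_behead.
move/node_inj: e1 => -> /= /eqP; rewrite ltn_eqF // ltnS; exact: leq_pred.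
Qed.

(** * Unravelling an ABox along first derivations *)

(** Only these two kinds of inclusions carry names from one individual to another; each entry will
    cost at most one child per node. *)
Definition propagated (N : seq nf_ci) : seq xname :=
  pmap (fun ci => match ci with
    | NExL _ _ B | NAllR _ _ B => Some B | _ => None end) N.

Lemma propagated_cat N1 N2 : propagated (N1 ++ N2) = propagated N1 ++ propagated N2.
Proof. exact: pmap_cat. Qed.

Lemma size_propagated_nf_def p C : size (propagated (nf_def p C)) <= concept_size C.
Proof.
elim: C p => //= [||D IH|D1 IH1 D2 IH2|D1 IH1 D2 IH2|R D IH|R D IH] [] //=.
- by apply: leq_trans (IH false) _.
- by rewrite propagated_cat size_cat; apply: leqW; apply: leq_add.
- by rewrite propagated_cat size_cat; apply: leqW; apply: leq_add.
- by rewrite propagated_cat size_cat; apply: leqW; apply: leq_add.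
- by apply: leq_trans (IH true) _; apply: leqW.
- by rewrite !ltnS; apply: leqW.
- by rewrite !ltnS; apply: leqW.
Qed.

(** Each quantifier yields at most one propagated name. The inclusion signs counted in [tbox_size]
    leave one unit per inclusion, which pays for the extra neighbour in [steps]. As [tbox_size]
    counts repeated inclusions once, so does the left side. *)
Lemma size_propagated T :
  size (propagated (normal_form (undup T))) + size (undup T) <= tbox_size T.
Proof.
rewrite /tbox_size; elim: (undup T) => [//|CD s IH]; rewrite big_cons.
have -> : size (propagated (normal_form (CD :: s))) =
    size (propagated (nf_def false CD.1)) + size (propagated (nf_def true CD.2)) +
    size (propagated (normal_form s)).
  by rewrite /normal_form /= !propagated_cat !size_cat.
by rewrite addnS -addnA addSn ltnS leq_add // leq_add // size_propagated_nf_def.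
Qed.

Lemma mem_normal_form_undup T : normal_form (undup T) =i normal_form T.
Proof.
move=> ci; apply/idP/idP => /mem_normal_form[CD h1 h2]; apply/mem_normal_form;
  by exists CD; rewrite ?mem_undup // mem_undup in h1 *.
Qed.

Lemma neighbour_derives_propagated T A m R out a b B :
  neighbour_derives (normal_form T) A m R out a b B ->
  B \in propagated (normal_form (undup T)).
Proof.
case=> C [_ h]; rewrite mem_pmap; apply/mapP.
by case: out h => -[_ h]; [exists (NExL R C B)|exists (NAllR C R B)];
  rewrite ?mem_normal_form_undup.
Qed.

Lemma neighbour_derives_le N A m n R out a b B : m <= n ->
  neighbour_derives N A m R out a b B -> neighbour_derives N A n R out a b B.
Proof. by move=> lemn [C [h1 h2]]; exists C; split=> //; apply: chase_stage_le h1. Qed.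

Definition step_in (A : abox) (a : iname) (st : step) : Prop :=
  if st.1.2 then (st.1.1, a, st.2) \in r_assertions A
  else (st.1.1, st.2, a) \in r_assertions A.

Lemma least_nat (P : nat -> Prop) : (exists n, P n) ->
  exists2 n, P n & forall m, P m -> n <= m.
Proof.
case=> n; elim/ltn_ind: n => n IH Pn.
have [[m [ltmn Pm]]|no] := classic (exists m, m < n /\ P m); first exact: IH ltmn Pm.
by exists n => // m Pm; rewrite leqNgt; apply/negP => ltmn; apply: no; exists m.
Qed.

(* Choosing the earliest derivation makes the same neighbour work at all stages. *)
Lemma first_step_exists N A b B : exists o : option step,
  (forall st, o = Some st -> step_in A b st) /\
  forall m R out c, neighbour_derives N A m R out b c B ->
    exists2 st, o = Some st & neighbour_derives N A m st.1.1 st.1.2 b st.2 B.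
Proof.
pose P m := exists st : step, neighbour_derives N A m st.1.1 st.1.2 b st.2 B.
have [ex|no] := classic (exists m, P m); last first.
  exists None; split=> // m R out c h; case: no; exists m, (R, out, c); exact: h.
have [m [st hst] hm] := least_nat ex.
exists (Some st); split=> [_ [<-]|n R out c h].
  by case: hst => C [_]; rewrite /step_in; case: (st.1.2) => -[].
exists st => //; apply: neighbour_derives_le hst; apply: hm.
by exists (R, out, c).
Qed.

Definition first_step (N : seq nf_ci) (A : abox) (b : iname) (B : xname) : option step :=
  proj1_sig (constructive_indefinite_description _ (first_step_exists N A b B)).

Definition adjacent (A : abox) (b : iname) : seq step :=
  [seq (x.1.1, true, x.2) | x <- r_assertions A & x.1.2 == b] ++
  [seq (x.1.1, false, x.1.2) | x <- r_assertions A & x.2 == b].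

Lemma mem_adjacent A b st : st \in adjacent A b <-> step_in A b st.
Proof.
case: st => [[R out] c]; rewrite mem_cat /step_in /=; split.
  by case/orP=> /mapP[[[R' x] y]]; rewrite mem_filter /= => /andP[/eqP<- h] [-> -> ->].
case: out => h; apply/orP; [left|right]; apply/mapP.
  by exists (R, b, c); rewrite ?mem_filter ?eqxx.
by exists (R, c, b); rewrite ?mem_filter ?eqxx.
Qed.

(* The extra neighbour guarantees that the root occurs in an assertion. *)
Definition steps (T : tbox) (A : abox) (b : iname) : seq step :=
  pmap (first_step (normal_form T) A b) (propagated (normal_form (undup T))) ++
  take 1 (adjacent A b).

Lemma size_steps T A b : T <> [::] -> size (steps T A b) <= tbox_size T.
Proof.
move=> Tn; apply: leq_trans (size_propagated T); rewrite size_cat leq_add //.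
  by rewrite size_pmap count_size.
apply: leq_trans (_ : 1 <= _); first by rewrite size_take; case: ltnP.
by rewrite lt0n size_eq0; apply/eqP => /undup_nil.
Qed.

Lemma steps_in T A b st : st \in steps T A b -> step_in A b st.
Proof.
rewrite mem_cat => /orP[|/mem_take/mem_adjacent //].
rewrite mem_pmap => /mapP[B _ /esym]; rewrite /first_step.
by case: constructive_indefinite_description => o [h _] /= /h.
Qed.

Lemma steps_derive T A m R out b c B :
  neighbour_derives (normal_form T) A m R out b c B ->
  exists2 st, st \in steps T A b &
    neighbour_derives (normal_form T) A m st.1.1 st.1.2 b st.2 B.
Proof.
move=> h; have : exists2 st, first_step (normal_form T) A b B = Some st &
    neighbour_derives (normal_form T) A m st.1.1 st.1.2 b st.2 B.
  rewrite /first_step; case: constructive_indefinite_description => o [_ ho] /=.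
  exact: ho h.
case=> st e hst; exists st => //; rewrite mem_cat; apply/orP; left.
rewrite mem_pmap -e; apply: map_f; exact: neighbour_derives_propagated h.
Qed.

Definition unravel (T : tbox) (A : abox) (a : iname) (n : nat) : abox :=
  tabox A (steps T A) a n.

Definition unravel_proj (T : tbox) (A : abox) (a : iname) (x : iname) : iname :=
  tlabel (steps T A) a (node_address x).

Lemma unravel_concept T A a n B x : (B, x) \in c_assertions (unravel T A a n) ->
  (B, unravel_proj T A a x) \in c_assertions A.
Proof. by case/tabox_concept=> w [_ -> h]; rewrite /unravel_proj nodeK. Qed.

Lemma unravel_role T A a n R x y : (R, x, y) \in r_assertions (unravel T A a n) ->
  (R, unravel_proj T A a x, unravel_proj T A a y) \in r_assertions A.
Proof.
case/tabox_role=> i [w []]; rewrite mem_taddr /= => /andP[_ /andP[hi _]].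
have := steps_in (mem_nth step0 hi); rewrite /step_in.
by case: (nth _ _ _).1.2 => h <- [-> ->]; rewrite /unravel_proj !nodeK.
Qed.

Lemma unravel_step T A a n w st : size w < n -> tvalid (steps T A) a w ->
  st \in steps T A (tlabel (steps T A) a w) ->
  exists2 i, i :: w \in taddr (steps T A) a n &
    nth step0 (steps T A (tlabel (steps T A) a w)) i = st.
Proof.
move=> sw vw hst; exists (index st (steps T A (tlabel (steps T A) a w))).
  by rewrite mem_taddr /= sw vw index_mem hst.
exact: nth_index.
Qed.

Lemma unravel_individual T A a n w : 0 < n -> w \in taddr (steps T A) a n ->
  tlabel (steps T A) a w \in individuals A -> node w \in individuals (unravel T A a n).
Proof.
move=> n0 hw hl; apply/individualsP.
have byrole i v : i :: v \in taddr (steps T A) a n -> w = v \/ w = i :: v ->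
    exists R b, (R, node w, b) \in r_assertions (unravel T A a n) \/
                (R, b, node w) \in r_assertions (unravel T A a n).
  have eq_cons_self : (i :: v == v) = false.
    by apply/eqP => /(congr1 size) /eqP; rewrite /= gtn_eqF.
  move=> hv e; pose st := nth step0 (steps T A (tlabel (steps T A) a v)) i.
  exists st.1.1; exists (if w == v then node (i :: v) else node v).
  case eo: st.1.2; case: e => ->; rewrite ?eqxx.
  - by left; apply/tabox_role; exists i, v; split=> //; rewrite -/st eo.
  - rewrite eq_cons_self; right; apply/tabox_role; exists i, v; split=> //; by rewrite -/st eo.
  - by right; apply/tabox_role; exists i, v; split=> //; rewrite -/st eo.
  - rewrite eq_cons_self; left; apply/tabox_role; exists i, v; split=> //; by rewrite -/st eo.
case: w hw hl byrole => [|i w] hw hl byrole; last by right; apply: (byrole i w); auto.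
case/individualsP: hl => [[B hB]|[R [b hb]]].
  by left; exists B; apply/tabox_concept; exists [::].
right; have : adjacent A a != [::].
  case: hb => hb; apply/eqP => e.
    by have /mem_adjacent : step_in A a (R, true, b); rewrite ?e.
  by have /mem_adjacent : step_in A a (R, false, b); rewrite ?e.
(* Child [0] of the root exists because [take 1] makes [steps] nonempty. *)
move=> adj; apply: (byrole 0 [::]); last by left.
rewrite mem_taddr n0 /= size_cat size_take andbT addn_gt0.
by case: (adjacent A a) adj => //= st [|s1 s] _; rewrite orbT.
Qed.

(** By [steps_derive] some chosen neighbour yields [B] at the same stage [m]. Its copy is a child of
    [w], where by assumption the required name holds. *)
Lemma unravel_propagates T A a n w m R out b B : size w < n ->
  tvalid (steps T A) a w ->
  (forall i, i :: w \in taddr (steps T A) a n -> forall C,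
    chase_stage (normal_form T) A m (FConcept C (Named (tlabel (steps T A) a (i :: w)))) ->
    chase T (unravel T A a n) (FConcept C (Named (node (i :: w))))) ->
  neighbour_derives (normal_form T) A m R out (tlabel (steps T A) a w) b B ->
  chase T (unravel T A a n) (FConcept B (Named (node w))).
Proof.
move=> sw vw hc /steps_derive[st hst].
have [i hi e] := unravel_step sw vw hst; rewrite -e.
case=> C [/(hc _ hi) hC h2].
have := @tabox_role A (steps T A) a n
  (nth step0 (steps T A (tlabel (steps T A) a w)) i).1.1.
move: h2; case eo: (nth _ _ i).1.2 => -[_ hN] hrole.
  apply: (@chase_closed T (unravel T A a n) _ hN) hC.
  by apply: chase_abox; apply: AF_role; apply/hrole; exists i, w; split=> //; rewrite eo.
apply: (@chase_closed T (unravel T A a n) _ hN) hC _.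
by apply: chase_abox; apply: AF_role; apply/hrole; exists i, w; split=> //; rewrite eo.
Qed.

(** What is derived by stage [k] uses names of neighbours from earlier stages only, so [k] levels of
    the tree below [w] suffice. *)
Lemma unravel_stage T A a n k w : 0 < n -> w \in taddr (steps T A) a n ->
  k + size w <= n -> forall m C, m <= k ->
  chase_stage (normal_form T) A m (FConcept C (Named (tlabel (steps T A) a w))) ->
  chase T (unravel T A a n) (FConcept C (Named (node w))).
Proof.
move=> n0; elim: k w => [|k IH] w hw kw m C lemk hC.
  move: lemk hC; rewrite leqn0 => /eqP-> /= hC; inversion hC; subst.
  by apply: chase_abox; apply: AF_concept; apply/tabox_concept; exists w.
(* Derivations that pass through nulls below the label are covered by this homomorphism; only the
   names arriving from neighbours need the induction hypothesis. *)
apply: (@chase_hom_below (normal_form T) A (tlabel (steps T A) a w) _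
  (chase_str T (unravel T A a n)) (Named (node w)) k.+1 _ _ _ _ m
  (FConcept C (Named (tlabel (steps T A) a w)))) => //.
- exact: chase_closed.
- by move=> hl; apply: chase_abox; apply: AF_ind; apply: unravel_individual.
- move=> B hB; apply: chase_abox; apply: AF_concept; apply/tabox_concept.
  by exists w.
move=> {C hC lemk}m R out b B ltmk; apply: unravel_propagates.
- by apply: leq_trans kw; rewrite addSn ltnS leq_addl.
- by move: hw; rewrite mem_taddr => /andP[].
move=> i hi C; apply: IH => //; by rewrite /= addnS -addSn.
Qed.

(* As only finitely many names are propagated, all of them reach the root of an
   unravelling of sufficient depth. *)
Lemma unravel_root T A a : exists2 n, 0 < n &
  forall m R out b B, neighbour_derives (normal_form T) A m R out a b B ->
  chase T (unravel T A a n) (FConcept B (Named (node [::]))).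
Proof.
pose D m B := exists st : step,
  neighbour_derives (normal_form T) A m st.1.1 st.1.2 a st.2 B.
have [|B _|n hn] := @uniform_bound _ (propagated (normal_form (undup T)))
    (fun n B => (exists m, D m B) -> D n B).
- move=> m n B lemn h /h[st hst]; exists st; exact: neighbour_derives_le hst.
- have [[m hm]|no] := classic (exists m, D m B); last by exists 0 => /no.
  by exists m.
(* One level more than [n]: the names of stage [n] must hold at the children of the root. *)
exists n.+1 => // m R out b B h.
have [|st] := hn _ (neighbour_derives_propagated h); first by exists m, (R, out, b).
apply: (@unravel_propagates T A a n.+1 [::]) => // i hi C; apply: (unravel_stage (k := n)) => //.
by rewrite /= addn1.
Qed.

(** Names denote themselves, so [x] cannot simply denote what [f x] does. In the new model each name
    is a copy of its image under [f], and all objects of the old model are kept as anonymous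
    ones. *)
Lemma consistent_hom T A A' (f : iname -> iname) :
  (forall B x, (B, x) \in c_assertions A' -> (B, f x) \in c_assertions A) ->
  (forall R x y, (R, x, y) \in r_assertions A' -> (R, f x, f y) \in r_assertions A) ->
  consistent T A -> consistent T A'.
Proof.
move=> fc fr [X [I [IT [Ic Ir]]]].
pose g (d : obj (obj X)) : obj X := match d with Named x => Named (f x) | Anon e => e end.
have ne : exists d, dom I (g d) by have [d hd] := dom_nonempty I; exists (Anon d).
pose J := @Interp (obj X) (fun d => dom I (g d)) (fun B d => cint I B (g d))
  (fun R d e => rint I R (g d) (g e)) ne (fun B d => @cint_dom _ I B (g d))
  (fun R d e => @rint_dom _ I R (g d) (g e)).
have extJ C d : ext J C d <-> ext I C (g d).
  elim: C d => //= [D IH|D1 IH1 D2 IH2|D1 IH1 D2 IH2|R D IH|R D IH] d.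
  - by rewrite IH.
  - by rewrite IH1 IH2.
  - by rewrite IH1 IH2.
  - split=> [[e [h1 /IH h2]]|[e [h1 h2]]]; first by exists (g e).
    by exists (Anon e); split=> //; apply/IH.
  - split=> -[h1 h2]; split=> // e; last by move/h2/IH.
    by move=> h3; apply/(IH (Anon e))/h2.
exists (obj X), J; split.
  by move=> C D CD d /extJ/(IT _ _ CD)/extJ.
by split=> [B x /fc/Ic|R x y /fr/Ir].
Qed.

(** * From tree-shaped ABoxes to arbitrary ones *)

Definition hom_below (T1 T2 : tbox) (S : signature) (A : abox) (a : iname)
    (h : obj null -> obj null) : Prop :=
  [/\ forall d, obj_base d = Some a -> chase T2 A (FDom d) -> chase T1 A (FDom (h d)),
      forall B d, sig_concept S B -> obj_base d = Some a ->
        chase T2 A (FConcept (Atom B) d) -> chase T1 A (FConcept (Atom B) (h d)),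
      forall R B d, sig_role S R -> obj_base d = Some a ->
        chase T2 A (FRole R d (fresh d R B)) ->
        chase T1 A (FRole R (h d) (h (fresh d R B)))
    & h (Named a) = Named a].

Lemma unravel_hom_embeddable T1 T2 Theta A a : T2 <> [::] -> horn T1 ->
  (forall A : abox,
     tree_shaped A -> sig_abox Theta.1 A -> outdegree_le A (tbox_size T2) ->
     consistent T1 A -> consistent T2 A ->
     hom_embeddable Theta.2 A (canonical_model T2 A) (canonical_model T1 A)) ->
  sig_abox Theta.1 A -> consistent T1 A -> consistent T2 A -> a \in individuals A ->
  exists h, hom_below T1 T2 Theta.2 A a h.
Proof.
move=> T2n hT1 emb [sc sr] c1 c2 aA.
have [n n0 hroot] := unravel_root T2 A a.
set A' := unravel T2 A a n in hroot; pose f := unravel_proj T2 A a.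
have fc B x : (B, x) \in c_assertions A' -> (B, f x) \in c_assertions A.
  exact: unravel_concept.
have fr R x y : (R, x, y) \in r_assertions A' -> (R, f x, f y) \in r_assertions A.
  exact: unravel_role.
have rA : node [::] \in individuals A' by apply: unravel_individual; rewrite ?mem_taddr.
have [k [kd kc kr kn]] : hom_embeddable Theta.2 A' (canonical_model T2 A') (canonical_model T1 A').
  apply: emb.
  - exact: tabox_tree_shaped.
  - by split=> [B x /fc/sc|R x y /fr/sr].
  - by apply: tabox_outdegree => // b; apply: size_steps.
  - exact: consistent_hom fc fr c1.
  - exact: consistent_hom fc fr c2.
(* The way back to [A]: under [f], the canonical model over [A] satisfies all assertions of the
   unravelling. *)
have [u [[ud uc ur] un]] : exists u,
    hom_into full_sig (canonical_model T1 A') (canonical_model T1 A) u /\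
    forall x, u (Named x) = Named (f x).
  apply: canonical_universal; first exact: canonical_model_tbox.
    by move=> B x /fc h; apply: chase_abox; apply: AF_concept.
  by move=> R x y /fr h; apply: chase_abox; apply: AF_role.
pose v := below_map (chase_str T2 A') (Named (node [::])).
have hv g : chase T2 A g -> preserves (chase_str T2 A') (fun d => obj_base d = Some a)
    (fresh_edge (fun d => obj_base d = Some a)) v g.
  case=> m; apply: (@chase_hom_below _ A a _ (chase_str T2 A') (Named (node [::])) m).
  - exact: chase_closed.
  - by move=> _; apply: chase_abox; apply: AF_ind.
  - move=> B hB; apply: chase_abox; apply: AF_concept; apply/tabox_concept.
    by exists [::]; rewrite mem_taddr.
  - by move=> l R out b B _; apply: hroot.
  - exact: leqnn.
(* [v] sends [a] to the root of the tree, [k] fixes the root, and [u] projects it to [a]. *)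
exists (u \o k \o v); split=> /=.
- by move=> d hd /hv/(_ hd); move/kd/ud.
- by move=> B d SB hd /hv/(_ hd)/(kc _ _ SB)/uc; apply.
- move=> R B d SR hd /hv h; apply: ur => //; apply: kr => //; apply: h.
  by split=> //; exists R, B.
- by rewrite /v /below_map /= kn // un /f /unravel_proj nodeK.
Qed.

(** The empty TBox is treated apart: its size 0 leaves no room for the extra neighbour in [steps].
    Its chase adds nothing to the ABox, so the identity is an embedding. *)
Lemma hom_embeddable_nil T1 A S :
  hom_embeddable S A (canonical_model [::] A) (canonical_model T1 A).
Proof.
have base f : chase [::] A f -> abox_facts A f.
  by case=> n; elim: n f => [//|n IH] f h; inversion h => //; subst; exact: IH.
exists id; split=> //=.
- by move=> d /base/chase_abox.
- by move=> B d _ /base/chase_abox.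
- by move=> R d e _ /base/chase_abox.
Qed.

Lemma tree_embeddings_hom_embeddable T1 T2 Theta A : horn T1 ->
  (forall A : abox,
     tree_shaped A -> sig_abox Theta.1 A -> outdegree_le A (tbox_size T2) ->
     consistent T1 A -> consistent T2 A ->
     hom_embeddable Theta.2 A (canonical_model T2 A) (canonical_model T1 A)) ->
  sig_abox Theta.1 A -> consistent T1 A -> consistent T2 A ->
  hom_embeddable Theta.2 A (canonical_model T2 A) (canonical_model T1 A).
Proof.
move=> hT1 emb sA c1 c2.
have [->|T2n] := classic (T2 = [::]); first exact: hom_embeddable_nil.
(* Without individuals there is nothing to unravel, but then [A] itself is tree-shaped. *)
have [e0|ne] := classic (individuals A = [::]).
  have r0 R x y : (R, x, y) \in r_assertions A -> False.
    move=> h; suff : x \in individuals A by rewrite e0.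
    by apply/individualsP; right; exists R, y; left.
  apply: emb => //; last by left.
  split; first by move=> x y; rewrite e0.
    have noedge x y : edge A x y = false by apply/negP => /hasP[[[R u] v] /r0].
    by case=> [|x [|y c]] //= _ /andP[]/=; rewrite noedge.
  by move=> R x y /r0.
pose ha a := epsilon (inhabits id) (hom_below T1 T2 Theta.2 A a).
have HP a : a \in individuals A -> hom_below T1 T2 Theta.2 A a (ha a).
  by move=> aA; apply: epsilon_spec; exact: unravel_hom_embeddable.
(* As there are individuals, [NullRoot] is absent and every element lies below one of them. *)
have based d : chase T2 A (FDom d) -> exists2 a, a \in individuals A & obj_base d = Some a.
  case=> n; elim: n d => [|n IH] d h; first by inversion h; subst=> //; exists a.
  inversion h; subst; first exact: IH.
  by case: H2 => // -[->]; rewrite obj_base_fresh; apply: IH; apply: chase_stage_dom H0.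
exists (fun d => if obj_base d is Some a then ha a d else d); split.
- by move=> d hd; have [a aA ea] := based _ hd; rewrite ea; have [h _ _ _] := HP a aA; apply: h.
- move=> B d SB hB; have [a aA ea] := based _ (chase_con_dom hB); rewrite ea.
  by have [_ h _ _] := HP a aA; apply: h.
(* An edge between individuals is an assertion, and each map fixes its own individual; any other
   edge stays below one individual. *)
- move=> R d e SR hR; case: (hR) => n /chase_stage_role.
  case=> [[x [y [-> -> h]]]|[B [C [ee _]]]] /=.
    have xA : x \in individuals A by apply/individualsP; right; exists R, y; left.
    have yA : y \in individuals A by apply/individualsP; right; exists R, x; right.
    have [_ _ _ ->] := HP x xA; have [_ _ _ ->] := HP y yA.
    by apply: chase_abox; apply: AF_role.
  rewrite ee in hR *; have [a aA ea] := based _ (chase_role_dom hR).1.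
  rewrite obj_base_fresh ea.
  by have [_ _ h _] := HP a aA; apply: h.
- by move=> a aA /=; have [_ _ _ ->] := HP a aA.
Qed.

Theorem theorem12 (T1 T2 : tbox) (Theta : signature * signature)
    (hT1 : horn T1) (hT2 : horn T2) :
  cq_entails Theta T1 T2 <->
  (forall A : abox,
     tree_shaped A -> sig_abox Theta.1 A -> outdegree_le A (tbox_size T2) ->
     consistent T1 A -> consistent T2 A ->
     hom_embeddable Theta.2 A (canonical_model T2 A) (canonical_model T1 A)).
Proof.
split=> [ent A _ sA _|emb A sA c1 c2 q qS a _ aA].
  exact: cq_entails_hom_embeddable.
have [h [hd hc hr hn]] := tree_embeddings_hom_embeddable hT1 emb sA c1 c2.
move/(kb_entails_canonical _ _ hT2 c2) => h2; apply/kb_entails_canonical => //.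
have hh : hom_into Theta.2 (canonical_model T2 A) (canonical_model T1 A) h by split.
by apply: (satisfies_hom hh qS) h2 => b /aA; apply: hn.
Qed.
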